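(* Let $A_1\in\mathbb{R}^{d\times 1}$, $A_1\neq 0$, let $B_k\in\mathbb{R}^{d\times m_k}$, $k=1,2,\dots$, be given with $m_k\ge 1$, and put $A_{k+1}=[A_k\ B_k]\in\mathbb{R}^{d\times n_{k+1}}$, where $n_1=1$, $n_{k+1}=n_k+m_k$ and all $n_k\le d$. Let $\tau\ge 0$ and run the Augmented SVD algorithm (described in the context) with threshold $\tau$. Then in each step the algorithm computes an approximate singular value decomposition of $A_k$: it represents orthogonal matrices $U_k\in\mathbb{R}^{d\times d}$, $V_k\in\mathbb{R}^{n_k\times n_k}$ and a nonnegative diagonal matrix $\Sigma_k\in\mathbb{R}^{d\times n_k}$ such that $A_k=U_k\Sigma_kV_k^T$ up to the perturbations introduced by the thresholding substep. If $\tau=0$, this is a precise SVD, i.e. $A_k=U_k\Sigma_kV_k^T$ exactly. Moreover, the $k$-th step (passing from the decomposition of $A_k$ to that of $A_{k+1}$) requires $$O\left(n_{k+1}^3+d\,m_k\,(r_k+m_k)\right)$$ floating point operations, and the memory consumption for storing the decomposition of $A_k$ is bounded by $O(n_k^2+r_k d)$. Here $r_k$ is the number of (strictly positive) singular values retained by the algorithm for $A_k$, and the $O$-constants are absolute.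
   Context: Complexity is counted in floating point operations of real arithmetic; an SVD of a $p\times p$ upper triangular matrix is counted as $O(p^3)$ operations. **Representation.** The decomposition of $A_k$ is stored as: a diagonal matrix $\Sigma_k'\in\mathbb{R}^{r_k\times r_k}$ with strictly positive diagonal; an orthogonal matrix $V_k\in\mathbb{R}^{n_k\times n_k}$; an orthogonal matrix $\widetilde U_k$ of size at most $n_k\times n_k$; and the Householder vectors $h_j\in\mathbb{R}^d$, $\|h_j\|_2=\sqrt2$, as columns of a matrix $H_k$. These represent $$\Sigma_k=\begin{bmatrix}\Sigma_k'&0\\ 0&0\end{bmatrix}\in\mathbb{R}^{d\times n_k},\qquad U_k=\begin{bmatrix}\widetilde U_k&0\\ 0&I\end{bmatrix}(I-h_1h_1^T)(I-h_2h_2^T)\cdots ,$$ the product running over the columns of $H_k$ in order. Identity blocks $I$ below always have the size needed for the dimensions to match (smaller orthogonal matrices are padded by an identity block when necessary). **Augmented SVD algorithm.** *Initialization.* Choose $h_1\in\mathbb{R}^d$ with $\|h_1\|_2=\sqrt2$ and $(I-h_1h_1^T)A_1=\|A_1\|_F\,e_1$. Set $\widetilde U_1=[\,]$ (empty, so that only the identity block is present), $V_1=[1]$, $r_1=n_1=1$, $\Sigma_1'=[\|A_1\|_F]$, $H_1=h_1$. *Step $k$, $k=1,2,\dots$* 1. Compute $Z=U_k^TB_k\in\mathbb{R}^{d\times m_k}$ by multiplying the top rows $B_{k,1}$ of $B_k$ by $\widetilde U_k^T$, leaving the remaining rows $B_{k,2}$ unchanged, and then applying the Householder reflections given by the columns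 of $H_k$ in reverse order. 2. Compute by Householder reflections the QR decomposition with column pivoting of the last $d-r_k$ rows of $Z$: $Z_{r_k+1:d,:}=Q\begin{bmatrix}R\\ 0\end{bmatrix}P$, where $Q=(I-y_1y_1^T)\cdots(I-y_py_p^T)\in\mathbb{R}^{(d-r_k)\times(d-r_k)}$, $\|y_j\|_2=\sqrt2$, $R\in\mathbb{R}^{m_k\times m_k}$ is upper triangular, $P\in\mathbb{R}^{m_k\times m_k}$ is a permutation matrix, and the process terminates after $p$ reflections when the remaining part to be reduced is zero. Set $g_j=\begin{bmatrix}0_{r_k}\\ {y_j}\end{bmatrix}\in\mathbb{R}^d$, $j=1,\dots,p$. 3. (Thresholding) Form the upper triangular matrix $$R_{k+1}=\begin{bmatrix}\Sigma_k'&Z_{1:r_k,:}P^T\\ 0&R\end{bmatrix}\in\mathbb{R}^{N\times N},\qquad N=r_k+m_k,$$ with diagonal entries $\rho_1,\dots,\rho_N$. Let $m$ be the smallest $j\in\{0,\dots,N-1\}$ with $|\rho_{j+1}|\le\sqrt{\tfrac{2}{(N-j)(N-j+1)}}\,\tau$ (and $m=N$ if there is no such $j$). Replace the trailing $(N-m)\times(N-m)$ diagonal block of $R_{k+1}$ by zero, compute an SVD $U\Sigma V^T$ of the resulting matrix with $U,V\in\mathbb{R}^{N\times N}$ orthogonal and singular values in decreasing order, and set all singular values $<\tau$ to zero. 4. Let $r_{k+1}$ be the number of remaining strictly positive singular values and let $\Sigma_{k+1}'$ be the leading $r_{k+1}\times r_{k+1}$ block of $\Sigma$. 5. (Update) Set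 $$\widetilde U_{k+1}=\begin{bmatrix}\widetilde U_k&0\\ 0&I\end{bmatrix}\begin{bmatrix}U&0\\ 0&I\end{bmatrix},\qquad V_{k+1}=\begin{bmatrix}V_k&0\\ 0&I_{m_k}\end{bmatrix}\begin{bmatrix}I_{r_k}&0&0\\ 0&0&I_{n_k-r_k}\\ 0&P^T&0\end{bmatrix}\begin{bmatrix}V&0\\ 0&I\end{bmatrix},$$ $$H_{k+1}=\begin{bmatrix}U^T&0\\ 0&I\end{bmatrix}[H_k,\,g_1,\dots,g_p].$$
   Formalization: For τ>0 the flop and memory bounds are proved with q_k, the number of stored Householder vectors (columns of H_k), in place of r_k, since H_k is never shortened and the bounds with r_k fail; for τ=0 they are proved with r_k as stated. *)

(* Defs.v *)
From HB Require Import structures.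
From mathcomp Require Import all_boot all_order all_algebra.
From mathcomp Require Import perm reals.

Set Implicit Arguments.
Unset Strict Implicit.
Unset Printing Implicit Defensive.

Import Order.TTheory GRing.Theory Num.Theory.
Local Open Scope ring_scope.

(** A value of type [counted T] is the result of a computation together with
    the number of floating point operations executed to obtain it.  Comparisons
    and sign changes are counted like the other operations; moving, copying
    and permuting data is free. *)

Definition counted (T : Type) : Type := (nat * T)%type.

Definition flops (T : Type) (c : counted T) : nat := c.1.
Definition value (T : Type) (c : counted T) : T := c.2.
Definition tick (T : Type) (k : nat) (x : T) : counted T := (k, x).
Definition ret (T : Type) (x : T) : counted T := tick 0 x.
Definition bind (T S : Type) (c : counted T) (f : T -> counted S) : counted S :=
  ((flops c + flops (f (value c)))%N, value (f (value c))).

Notation "'let*' x := e 'in' f" := (bind e (fun x => f))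
  (at level 200, x name, e at level 200, f at level 200, right associativity).

Section Kernels.
Variable R : realType.

Definition cadd (x y : R) : counted R := tick 1 (x + y).
Definition csub (x y : R) : counted R := tick 1 (x - y).
Definition cmul (x y : R) : counted R := tick 1 (x * y).
Definition cdiv (x y : R) : counted R := tick 1 (x / y).
Definition csqrt (x : R) : counted R := tick 1 (Num.sqrt x).
Definition cabs (x : R) : counted R := tick 1 `|x|.
Definition cle (x y : R) : counted bool := tick 1 (x <= y).
Definition clt (x y : R) : counted bool := tick 1 (x < y).

(* Loops: the n summands are computed and accumulated by n additions; the
   entries of a table are computed one after the other. *)
Definition csum (n : nat) (f : 'I_n -> counted R) : counted R :=
  ((\sum_(i < n) (flops (f i)).+1)%N, \sum_(i < n) value (f i)).

Definition ctab (T : Type) (a b : nat) (f : 'I_a -> 'I_b -> counted T) :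
    counted 'M[T]_(a, b) :=
  ((\sum_(i < a) \sum_(j < b) flops (f i j))%N,
   \matrix_(i < a, j < b) value (f i j)).

Fixpoint cmap (T S : Type) (f : T -> counted S) (s : seq T) : counted (seq S) :=
  if s is x :: s' then
    let* y := f x in let* t := cmap f s' in ret (y :: t)
  else ret [::].

(* Entry (i, j), read as 0 outside the matrix: sub-blocks whose dimensions are
   only known at run time can then be described without casts. *)
Definition ent (a b : nat) (A : 'M[R]_(a, b)) (i j : nat) : R :=
  match (insub i : option 'I_a), (insub j : option 'I_b) with
  | Some i', Some j' => A i' j'
  | _, _ => 0
  end.

(* the a x b block of A with upper left corner (i0, j0), filled up by zeros *)
Definition blk (a b i0 j0 a' b' : nat) (A : 'M[R]_(a', b')) : 'M[R]_(a, b) :=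
  \matrix_(i < a, j < b) ent A (i0 + i) (j0 + j).

(* [A 0; 0 I] of order s (for a <= s) *)
Definition padI (s a : nat) (A : 'M[R]_a) : 'M[R]_s :=
  \matrix_(i < s, j < s)
    if (i < a)%N && (j < a)%N then ent A i j else (i == j)%:R.

Definition frob (a b : nat) (A : 'M[R]_(a, b)) : R :=
  Num.sqrt (\sum_(i < a) \sum_(j < b) A i j ^+ 2).

Definition e1 (d : nat) : 'cV[R]_d := \col_(i < d) ((i : nat) == 0)%N%:R.

Definition orthogonal_mx (a : nat) (A : 'M[R]_a) : Prop := A^T *m A = 1%:M.

Definition refl (d : nat) (h : 'cV[R]_d) : 'M[R]_d := 1%:M - h *m h^T.

(* (I - h_1 h_1^T) (I - h_2 h_2^T) ... *)
Definition refls (d : nat) (hs : seq 'cV[R]_d) : 'M[R]_d :=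
  foldr (fun h M => refl h *m M) 1%:M hs.

Definition cmulmx (a b c : nat) (A : 'M[R]_(a, b)) (B : 'M[R]_(b, c)) :
    counted 'M[R]_(a, c) :=
  ctab (fun i k => csum (fun j => cmul (A i j) (B j k))).

(* [M 0; 0 I] * X, touching only the top rows of X *)
Definition cmultop (N d m : nat) (M : 'M[R]_N) (X : 'M[R]_(d, m)) :
    counted 'M[R]_(d, m) :=
  ctab (fun i j =>
    if (insub (i : nat) : option 'I_N) is Some i'
    then csum (fun l : 'I_N => cmul (M i' l) (ent X l j))
    else ret (X i j)).

(* X - h (h^T X) *)
Definition crefl (d m : nat) (h : 'cV[R]_d) (X : 'M[R]_(d, m)) :
    counted 'M[R]_(d, m) :=
  let* t := cmulmx h^T X in
  ctab (fun i j => let* u := cmul (h i 0) (t 0 j) in csub (X i j) u).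

(* The first vector of the list acts first, so the result is
   ... (I - h_2 h_2^T) (I - h_1 h_1^T) X = (refls hs)^T X. *)
Fixpoint crefls (d m : nat) (hs : seq 'cV[R]_d) (X : 'M[R]_(d, m)) :
    counted 'M[R]_(d, m) :=
  if hs is h :: hs' then let* Y := crefl h X in crefls hs' Y else ret X.

Record svd_out (N : nat) := SvdOut {
  svdU : 'M[R]_N; svdS : 'rV[R]_N; svdV : 'M[R]_N }.

Definition is_svd (N : nat) (T : 'M[R]_N) (o : svd_out N) : Prop :=
  [/\ orthogonal_mx (svdU o), orthogonal_mx (svdV o),
      forall j, 0 <= svdS o 0 j,
      forall i j : 'I_N, (i <= j)%N -> svdS o 0 j <= svdS o 0 i &
      T = svdU o *m diag_mx (svdS o) *m (svdV o)^T].

(* The choices which the algorithm leaves open. *)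
Record routines := Routines {
  svd : forall N, 'M[R]_N -> svd_out N;
  svdP : forall N (T : 'M[R]_N),
    (forall i j : 'I_N, (j < i)%N -> T i j = 0) -> is_svd T (svd T);
  (* the tie-breaking rule of the column pivoting: a position of the largest
     among the entries j, j + 1, ... of nu *)
  pivot : forall m, 'I_m -> 'rV[R]_m -> 'I_m;
  pivotP : forall m (j : 'I_m) (nu : 'rV[R]_m),
    (j <= pivot j nu)%N /\
    forall c : 'I_m, (j <= c)%N -> nu 0 c <= nu 0 (pivot j nu);
  (* the sign of a reflector: a column of norm alpha with leading entry x is
     mapped to -alpha e_1 or alpha e_1, different from the column itself *)
  rsign : R -> R -> bool;
  rsignP : forall x alpha, 0 < alpha -> x != (-1) ^+ rsign x alpha * alpha
}.

Variable K : routines.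

(* The vector y, |y| = sqrt 2, zero above position j, whose reflection maps
   the part of column j of W from row j on to a multiple of a unit vector; nu
   is the squared norm of that part. *)
Definition house (a m : nat) (W : 'M[R]_(a, m)) (j : 'I_m) (nu : R) :
    counted 'cV[R]_a :=
  let* alpha := csqrt nu in
  let* neg := tick 1 (rsign K (ent W j j) alpha) in
  let* vj := (if neg then cadd (ent W j j) alpha
              else csub (ent W j j) alpha) in
  let v := \col_(i < a) (if (i < j)%N then 0
                         else if (i == j :> nat) then vj else W i j) in
  let* v2 := csum (fun i => cmul (v i 0) (v i 0)) in
  let* nv := csqrt v2 in
  let* s2 := csqrt 2 in
  let* c := cdiv s2 nv in
  ctab (fun i l => cmul c (v i l)).

(* Z = (refls qrY) qrW qrP, with qrW = [R; 0] *)
Record qr_out (a m : nat) := QrOut {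
  qrW : 'M[R]_(a, m); qrP : 'M[R]_m; qrY : seq 'cV[R]_a }.

Fixpoint qr_loop (a m : nat) (js : seq 'I_m)
    (W : 'M[R]_(a, m)) (P : 'M[R]_m) (ys : seq 'cV[R]_a) :
    counted (qr_out a m) :=
  if js is j :: js' then
    let* nu := ctab (fun (_ : 'I_1) (c : 'I_m) =>
      if (j <= c)%N
      then csum (fun i : 'I_a =>
             if (j <= i)%N then cmul (W i c) (W i c) else ret 0)
      else ret 0) in
    let* c := tick m (pivot K j nu) in
    let* stop := tick 1 (nu 0 c == 0) in
    if stop then ret (QrOut W P ys) else
    let W1 := xcol j c W in
    let* y := house W1 j (nu 0 c) in
    let* W2 := crefl y W1 in
    qr_loop js' W2 (xrow j c P) (rcons ys y)
  else ret (QrOut W P ys).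

Definition qrcp (a m : nat) (Z : 'M[R]_(a, m)) : counted (qr_out a m) :=
  qr_loop (enum 'I_m) Z 1%:M [::].

(* Ut is the small orthogonal factor, of order us, sg the positive diagonal, and
   hs the list of the columns of H. *)
Record decomp (d n : nat) := Decomp {
  rk : nat;
  sg : 'rV[R]_rk;
  Vm : 'M[R]_n;
  us : nat;
  Ut : 'M[R]_us;
  hs : seq 'cV[R]_d }.

Definition U_of (d n : nat) (D : decomp d n) : 'M[R]_d :=
  padI d (Ut D) *m refls (hs D).

Definition Sigma_of (d n : nat) (D : decomp d n) : 'M[R]_(d, n) :=
  blk d n 0 0 (diag_mx (sg D)).

(* hs D grows by one vector per reflector and is never shortened, so for a
   positive threshold it may be longer than rk D. *)
Definition storage (d n : nat) (D : decomp d n) : nat :=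
  (rk D + n ^ 2 + us D ^ 2 + d * size (hs D))%N.

Definition well_formed (d n : nat) (D : decomp d n) : Prop :=
  [/\ (rk D <= n)%N /\ (us D <= n)%N,
      forall i, 0 < sg D 0 i,
      orthogonal_mx (Ut D) &
      forall h, h \in hs D -> frob h = Num.sqrt 2].

(* [I_r 0 0; 0 0 I_(n-r); 0 Q 0] *)
Definition shuffle (n r m : nat) (Q : 'M[R]_m) : 'M[R]_(n + m) :=
  \matrix_(i, j)
    if (j < r)%N then (i == j)%:R
    else if (j < r + m)%N then
      (if (n <= i)%N then ent Q (i - n) (j - r) else 0)
    else (i + m == j)%N%:R.

(* so_E is not part of the data kept by the algorithm: it is the perturbation
   caused by the thresholding in this step. *)
Record step_out (d n m : nat) := StepOut {
  so_D : decomp d (n + m);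
  so_E : 'M[R]_(d, n + m) }.

(* An SVD of order N is charged with csvd * N^3 operations.  The multiplications
   by the permutations P^T and S are charged like general matrix products. *)
Definition step (csvd : nat) (tau : R) (d n m : nat)
    (D : decomp d n) (B : 'M[R]_(d, m)) : counted (step_out d n m) :=
  let r := rk D in
  let N := (r + m)%N in
  let* Z0 := cmultop (Ut D)^T B in
  let* Z := crefls (hs D) Z0 in
  let* F := qrcp (blk (d - r) m r 0 Z) in
  let P := qrP F in
  let gs := [seq blk d 1 0 0 (col_mx (0 : 'cV[R]_r) y) | y <- qrY F] in
  let* ZP := cmulmx (blk r m 0 0 Z) P^T in
  let T0 : 'M[R]_N := block_mx (diag_mx (sg D)) ZP 0 (blk m m 0 0 (qrW F)) in
  let* small := ctab (fun (_ : 'I_1) (j : 'I_N) =>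
    let* x := cabs (T0 j j) in
    let* p := cmul (N - j)%N%:R (N - j + 1)%N%:R in
    let* q := cdiv 2 p in
    let* w := csqrt q in
    let* t := cmul w tau in
    cle x t) in
  let mm := find (fun j : 'I_N => small 0 j) (enum 'I_N) in
  let T : 'M[R]_N := \matrix_(i, j)
    if (mm <= i)%N && (mm <= j)%N then 0 else T0 i j in
  let* o := tick (csvd * N ^ 3) (svd K T) in
  let* drop := ctab (fun (_ : 'I_1) (j : 'I_N) => clt (svdS o 0 j) tau) in
  let s : 'rV[R]_N := \row_j (if drop 0 j then 0 else svdS o 0 j) in
  let* r' := tick N #|[pred j | 0 < s 0 j]| in
  let w := maxn (us D) N in
  let* Ut' := cmulmx (padI w (Ut D)) (padI w (svdU o)) in
  let S := shuffle n r P^T in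
  let* V1 := cmulmx (padI (n + m) (Vm D)) S in
  let* V' := cmulmx V1 (padI (n + m) (svdV o)) in
  let* hs' := cmap (cmultop (svdU o)^T) (hs D ++ gs) in
  (* The thresholding replaces T0 by svdU o * diag s * (svdV o)^T; the factors
     on both sides carry the difference over to the augmented matrix. *)
  let E := U_of D *m refls gs
           *m blk d (n + m) 0 0
                (T0 - svdU o *m diag_mx s *m (svdV o)^T)
           *m (padI (n + m) (Vm D) *m S)^T in
  ret (StepOut (Decomp (blk 1 r' 0 0 s) V' Ut' hs') E).

(** Indices are shifted by one: [dimn m k], [Amat A1 B k], [run ... k] and
    [B k] are n_(k+1), A_(k+1), its decomposition, and B_(k+1). *)

Fixpoint dimn (m : nat -> nat) (k : nat) : nat :=
  if k is k'.+1 then (dimn m k' + m k')%N else 1%N.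

Fixpoint Amat (d : nat) (m : nat -> nat) (A1 : 'cV[R]_d)
    (B : forall k, 'M[R]_(d, m k)) (k : nat) : 'M[R]_(d, dimn m k) :=
  match k return 'M[R]_(d, dimn m k) with
  | 0 => A1
  | k'.+1 => row_mx (Amat A1 B k') (B k')
  end.

Definition init (d : nat) (A1 h1 : 'cV[R]_d) : decomp d 1 :=
  @Decomp d 1 1 (const_mx (frob A1)) 1%:M 0 1%:M [:: h1].

Fixpoint run (csvd : nat) (tau : R) (d : nat) (m : nat -> nat)
    (A1 h1 : 'cV[R]_d) (B : forall k, 'M[R]_(d, m k)) (k : nat) :
    decomp d (dimn m k) :=
  match k return decomp d (dimn m k) with
  | 0 => init A1 h1
  | k'.+1 => so_D (value (step csvd tau (run csvd tau A1 h1 B k') (B k')))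
  end.

Fixpoint perturbation (csvd : nat) (tau : R) (d : nat) (m : nat -> nat)
    (A1 h1 : 'cV[R]_d) (B : forall k, 'M[R]_(d, m k)) (k : nat) :
    'M[R]_(d, dimn m k) :=
  match k return 'M[R]_(d, dimn m k) with
  | 0 => 0
  | k'.+1 =>
      row_mx (perturbation csvd tau A1 h1 B k') 0
      + so_E (value (step csvd tau (run csvd tau A1 h1 B k') (B k')))
  end.

Definition step_flops (csvd : nat) (tau : R) (d : nat) (m : nat -> nat)
    (A1 h1 : 'cV[R]_d) (B : forall k, 'M[R]_(d, m k)) (k : nat) : nat :=
  flops (step csvd tau (run csvd tau A1 h1 B k) (B k)).

End Kernels.

(* Main.v *)
(** One step rewrites [A_k B] as U [Sigma Z] diag(V, I)^T with Z = U^T B.  The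
    shuffling S of the columns and the reflectors g of the pivoted QR
    decomposition turn [Sigma Z] into refls(g) T0 S^T, T0 being the triangular
    matrix of order N = r + m padded by zeros, and an SVD of the thresholded T0
    only multiplies the outer factors by padded orthogonal matrices.  The left
    factor keeps its shape because refls(h) M = M refls(M^T h) for orthogonal M.

    For tau = 0 the first zero on the diagonal of T0 comes after r + p nonzero
    ones, p being the number of reflectors, and all rows from there on vanish,
    so the thresholding changes nothing and T0 has rank at least r + p.  Hence
    the number of stored reflectors never exceeds the number of singular
    values. *)
Require Import Defs.
From mathcomp Require Import all_boot all_order all_algebra.
From mathcomp Require Import perm reals.
From mathcomp Require Import zify ring lra.

Set Implicit Arguments.
Unset Strict Implicit.
Unset Printing Implicit Defensive.

Import Order.TTheory GRing.Theory Num.Theory.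
Local Open Scope ring_scope.

Local Arguments bind : simpl never.

(** * Zero and identity padding of blocks, and products of Householder reflections *)

Section Blocks.
Variable R : realType.

Lemma ent_ord (a b : nat) (A : 'M[R]_(a, b)) (i : 'I_a) (j : 'I_b) :
  ent A i j = A i j.
Proof. by rewrite /ent (valK i) (valK j). Qed.

Lemma ent_out (a b : nat) (A : 'M[R]_(a, b)) (i j : nat) :
  (a <= i)%N || (b <= j)%N -> ent A i j = 0.
Proof.
rewrite /ent; case: insubP => // i' Hi _; case: insubP => // j' Hj _.
by rewrite leqNgt Hi leqNgt Hj.
Qed.

(** Case analysis for [ent]: either genuine ordinals are supplied together with the entry, or the
    default 0 is read outside the matrix. *)
Variant ent_spec (a b : nat) (A : 'M[R]_(a, b)) (i j : nat) : R -> Type :=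
| EntIn (i' : 'I_a) (j' : 'I_b) of i = i' & j = j' : ent_spec A i j (A i' j')
| EntOut of (a <= i)%N || (b <= j)%N : ent_spec A i j 0.

Lemma entP (a b : nat) (A : 'M[R]_(a, b)) (i j : nat) :
  ent_spec A i j (ent A i j).
Proof.
have [ai|ia] := leqP a i; first by rewrite ent_out ?ai //; constructor; rewrite ai.
have [bj|jb] := leqP b j.
  by rewrite ent_out ?bj ?orbT //; constructor; rewrite bj orbT.
by rewrite (ent_ord A (Ordinal ia) (Ordinal jb)); constructor.
Qed.

(** With the target dimensions written as sums, [blk] and likewise [padI] become [block_mx], so the
    product rules below reduce to [mulmx_block]. *)
Lemma blk_block (a b c e : nat) (A : 'M[R]_(a, b)) :
  blk (a + c) (b + e) 0 0 A = block_mx A 0 0 0.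
Proof.
apply/matrixP=> i j; rewrite mxE !add0n; case: (entP A) => [i' j' Ei Ej|H].
  have -> : i = lshift c i' by apply: val_inj.
  have -> : j = lshift e j' by apply: val_inj.
  by rewrite block_mxEul.
case: (split_ordP i) H => i' -> /=; case: (split_ordP j) => j' -> /= H.
- by case/orP: H => /=; rewrite leqNgt ltn_ord.
- by rewrite block_mxEur mxE.
- by rewrite block_mxEdl mxE.
- by rewrite block_mxEdr mxE.
Qed.

Lemma padI_block (a c : nat) (A : 'M[R]_a) :
  padI (a + c) A = block_mx A 0 0 1%:M.
Proof.
apply/matrixP=> i j; rewrite mxE.
case: (split_ordP i) => i' ->; case: (split_ordP j) => j' ->.
- by rewrite (ent_ord A i' j') block_mxEul.
- by rewrite block_mxEur mxE eq_shift.
- by rewrite block_mxEdl mxE eq_shift.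
- by rewrite block_mxEdr mxE eq_shift.
Qed.

Lemma padI_mul (d a : nat) (A B : 'M[R]_a) : (a <= d)%N ->
  padI d (A *m B) = padI d A *m padI d B.
Proof.
move/subnKC <-; rewrite !padI_block mulmx_block.
by rewrite !mulmx0 !mul0mx mulmx1 !addr0 add0r.
Qed.

Lemma padI_tr (d a : nat) (A : 'M[R]_a) : (padI d A)^T = padI d A^T.
Proof.
apply/matrixP=> i j; rewrite !mxE andbC eq_sym.
by case: ifP => // /andP[ia ja]; case: (entP A) => [i' j' -> ->|];
  rewrite ?ent_ord ?mxE // leqNgt ja leqNgt ia.
Qed.

Lemma padI1 (d a : nat) : padI d (1%:M : 'M[R]_a) = 1%:M.
Proof.
apply/matrixP=> i j; rewrite !mxE; case: ifP => // /andP[ia ja].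
by rewrite (ent_ord _ (Ordinal ia) (Ordinal ja)) mxE.
Qed.

(** The updated small orthogonal factor is a product of matrices padded to an intermediate order
    [w], which is then padded again to order [d]. *)
Lemma padI_padI (d w a : nat) (A : 'M[R]_a) : (a <= w <= d)%N ->
  padI d (padI w A) = padI d A.
Proof.
case/andP=> aw wd; apply/matrixP=> i j; rewrite !mxE.
case: ifP => [/andP[iw jw]|].
  by rewrite (ent_ord _ (Ordinal iw) (Ordinal jw)) mxE.
move/negbT; rewrite negb_and -!leqNgt => H.
case: ifP => // /andP[ia ja].
by move: H; rewrite leqNgt (leq_trans ia aw) leqNgt (leq_trans ja aw).
Qed.

Lemma padI_mul_blk (d a b c : nat) (A : 'M[R]_a) (X : 'M[R]_(a, b)) :
  (a <= d)%N -> (b <= c)%N -> padI d A *m blk d c 0 0 X = blk d c 0 0 (A *m X).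
Proof.
move=> /subnKC <- /subnKC <-; rewrite padI_block !blk_block mulmx_block.
by rewrite !mulmx0 !mul0mx !addr0.
Qed.

Lemma blk_mul_padI (d a b c : nat) (X : 'M[R]_(a, b)) (A : 'M[R]_b) :
  (a <= d)%N -> (b <= c)%N -> blk d c 0 0 X *m padI c A = blk d c 0 0 (X *m A).
Proof.
move=> /subnKC <- /subnKC <-; rewrite padI_block !blk_block mulmx_block.
by rewrite !mulmx0 !mul0mx !addr0.
Qed.

Lemma padI_orthogonal (d a : nat) (A : 'M[R]_a) : (a <= d)%N ->
  orthogonal_mx A -> orthogonal_mx (padI d A).
Proof. by move=> ad HA; rewrite /orthogonal_mx padI_tr -padI_mul // HA padI1. Qed.

Lemma orthogonal_mul (a : nat) (A B : 'M[R]_a) :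
  orthogonal_mx A -> orthogonal_mx B -> orthogonal_mx (A *m B).
Proof.
by rewrite /orthogonal_mx => HA HB; rewrite trmx_mul -mulmxA (mulmxA A^T) HA mul1mx.
Qed.

Lemma orthogonal1 (a : nat) : orthogonal_mx (1%:M : 'M[R]_a).
Proof. by rewrite /orthogonal_mx trmx1 mul1mx. Qed.

Lemma orthogonal_tr (a : nat) (A : 'M[R]_a) :
  orthogonal_mx A -> orthogonal_mx A^T.
Proof. by rewrite /orthogonal_mx trmxK => /mulmx1C. Qed.

Lemma orthogonalK (a b : nat) (A : 'M[R]_a) (X : 'M[R]_(a, b)) :
  orthogonal_mx A -> A *m (A^T *m X) = X.
Proof. by move=> /mulmx1C H; rewrite mulmxA H mul1mx. Qed.

(** The norm condition enters all computations with reflections in the algebraic form h^T h = 2. *)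
Lemma frob_sqrt2P (d : nat) (h : 'cV[R]_d) :
  (frob h = Num.sqrt 2) <-> (h^T *m h = 2%:M).
Proof.
have E : (h^T *m h) 0 0 = \sum_(i < d) \sum_(j < 1) h i j ^+ 2.
  by rewrite mxE; apply: eq_bigr => i _; rewrite big_ord1 mxE expr2.
have E0 : 0 <= \sum_(i < d) \sum_(j < 1) h i j ^+ 2.
  by rewrite !sumr_ge0 // => i _; rewrite !sumr_ge0 // => j _; rewrite sqr_ge0.
rewrite /frob -E in E0 *; split=> [H|->]; last by rewrite mxE eqxx.
apply/matrixP=> i j; rewrite !ord1 [RHS]mxE eqxx.
by rewrite -[LHS]sqr_sqrtr // H sqr_sqrtr.
Qed.

Lemma refl_sym (d : nat) (h : 'cV[R]_d) : (refl h)^T = refl h.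
Proof. by rewrite /refl linearB /= trmx1 trmx_mul trmxK. Qed.

Lemma refl_mul (d b : nat) (h : 'cV[R]_d) (X : 'M[R]_(d, b)) :
  refl h *m X = X - h *m (h^T *m X).
Proof. by rewrite /refl mulmxBl mul1mx mulmxA. Qed.

(** From h^T (I - h h^T) = h^T - 2 h^T = - h^T, the square of the symmetric matrix I - h h^T is I -
    h h^T + h h^T = I. *)
Lemma refl_orthogonal (d : nat) (h : 'cV[R]_d) :
  frob h = Num.sqrt 2 -> orthogonal_mx (refl h).
Proof.
move/frob_sqrt2P=> H; rewrite /orthogonal_mx refl_sym refl_mul {2}/refl.
rewrite mulmxBr mulmx1 (mulmxA h^T) H mul_scalar_mx scaler_nat mulr2n opprD addrA subrr add0r.
by rewrite mulmxN opprK /refl subrK.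
Qed.

Lemma refls_orthogonal (d : nat) (hs : seq 'cV[R]_d) :
  (forall h, h \in hs -> frob h = Num.sqrt 2) -> orthogonal_mx (refls hs).
Proof.
elim: hs => [_|h hs IH H] /=; first exact: orthogonal1.
apply: orthogonal_mul; first by apply: refl_orthogonal; apply: H; rewrite mem_head.
by apply: IH => h' h'hs; apply: H; rewrite inE h'hs orbT.
Qed.

Lemma refls_cat (d : nat) (s1 s2 : seq 'cV[R]_d) :
  refls (s1 ++ s2) = refls s1 *m refls s2.
Proof. by elim: s1 => [|h s1 IH] /=; rewrite ?mul1mx // IH mulmxA. Qed.

(** Since M M^T h = h, each reflector satisfies M (I - M^T h h^T M) = (I - h h^T) M. Thus an
    orthogonal factor on the right of the reflections moves to their left once the vectors are
    multiplied by its transpose. *)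
Lemma refls_conj (d : nat) (M : 'M[R]_d) (hs : seq 'cV[R]_d) :
  orthogonal_mx M ->
  M *m refls [seq M^T *m h | h <- hs] = refls hs *m M.
Proof.
move=> HM; elim: hs => [|h hs IH] /=; first by rewrite mulmx1 mul1mx.
rewrite -[RHS]mulmxA -IH !mulmxA; congr (_ *m _).
rewrite /refl mulmxBl mulmxBr mulmx1 mul1mx trmx_mul trmxK.
by rewrite -!mulmxA orthogonalK.
Qed.

Lemma frob_mul_orthogonal (d : nat) (M : 'M[R]_d) (h : 'cV[R]_d) :
  orthogonal_mx M -> frob h = Num.sqrt 2 -> frob (M *m h) = Num.sqrt 2.
Proof.
move=> HM /frob_sqrt2P H; apply/frob_sqrt2P.
by rewrite trmx_mul -mulmxA (mulmxA M^T) HM mul1mx.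
Qed.

End Blocks.

(** * Results and operation counts of the elementary kernels *)

Section Kernels.
Variable R : realType.

Lemma value_bind (T S : Type) (c : counted T) (f : T -> counted S) :
  value (bind c f) = value (f (value c)).
Proof. by []. Qed.

Lemma flops_bind (T S : Type) (c : counted T) (f : T -> counted S) :
  flops (bind c f) = (flops c + flops (f (value c)))%N.
Proof. by []. Qed.

Lemma flops_ctab_le (T : Type) (a b k : nat) (f : 'I_a -> 'I_b -> counted T) :
  (forall i j, (flops (f i j) <= k)%N) -> (flops (ctab f) <= a * b * k)%N.
Proof.
move=> H; apply: (@leq_trans (\sum_(i < a) \sum_(j < b) k)).
  by apply: leq_sum => i _; apply: leq_sum => j _; apply: H.
by rewrite !sum_nat_const !card_ord mulnA.
Qed.

Lemma flops_csum_le (n k : nat) (f : 'I_n -> counted R) :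
  (forall i, (flops (f i) <= k)%N) -> (flops (csum f) <= n * k.+1)%N.
Proof.
move=> H; apply: (@leq_trans (\sum_(i < n) k.+1)).
  by apply: leq_sum => i _; rewrite ltnS.
by rewrite sum_nat_const card_ord.
Qed.

Lemma value_cmulmx (a b c : nat) (A : 'M[R]_(a, b)) (B : 'M[R]_(b, c)) :
  value (cmulmx A B) = A *m B.
Proof. by apply/matrixP=> i j; rewrite !mxE. Qed.

Lemma flops_cmulmx (a b c : nat) (A : 'M[R]_(a, b)) (B : 'M[R]_(b, c)) :
  (flops (cmulmx A B) <= a * c * (b * 2))%N.
Proof. by apply: flops_ctab_le => i j; apply: flops_csum_le. Qed.

Lemma value_cmultop (N d m : nat) (M : 'M[R]_N) (X : 'M[R]_(d, m)) :
  (N <= d)%N -> value (cmultop M X) = padI d M *m X.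
Proof.
move=> Nd; apply/matrixP=> i j; rewrite !mxE.
case: insubP => [i' iN Ei|]; last first.
  rewrite -leqNgt => Ni /=; rewrite (bigD1 i) //= big1 ?addr0 => [|l li].
    by rewrite !mxE ltnNge Ni /= eqxx mul1r.
  by rewrite !mxE ltnNge Ni /= eq_sym (negPf li) mul0r.
(* Reading both factors through [ent] makes the summand a function of a natural number, so that the
   range can be widened from [N] to [d]. *)
transitivity (\sum_(l < N) ent M i' l * ent X l j).
  by apply: eq_bigr => l _; rewrite ent_ord.
rewrite (big_ord_widen _ (fun l => ent M i' l * ent X l j) Nd) big_mkcond.
apply: eq_bigr => l _; rewrite !mxE iN -Ei /=; case: ltnP => lN.
  by rewrite ent_ord.
case: eqP => [E|]; last by rewrite mul0r.
by move: iN; rewrite E ltnNge lN.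
Qed.

(** Rows from [N] on are copied free of charge, which keeps [d] out of the bound. *)
Lemma flops_cmultop (N d m : nat) (M : 'M[R]_N) (X : 'M[R]_(d, m)) :
  (N <= d)%N -> (flops (cmultop M X) <= N * m * (N * 2))%N.
Proof.
move=> Nd; rewrite /flops /=.
apply: (@leq_trans (\sum_(i < d) if (i < N)%N then m * (N * 2) else 0)); last first.
  rewrite -big_mkcond /= -(big_ord_widen _ (fun _ => m * (N * 2))%N Nd).
  by rewrite sum_nat_const card_ord mulnA.
apply: leq_sum => i _; case: insubP => [i' _ Ei|/negPf ->]; last first.
  by rewrite big1.
rewrite -Ei ltn_ord; apply: (@leq_trans (\sum_(j < m) N * 2)).
  by apply: leq_sum => j _; apply: flops_csum_le.
by rewrite sum_nat_const card_ord.
Qed.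

Lemma value_crefl (d m : nat) (h : 'cV[R]_d) (X : 'M[R]_(d, m)) :
  value (crefl h X) = refl h *m X.
Proof.
rewrite refl_mul /crefl value_bind value_cmulmx; apply/matrixP=> i j.
rewrite [LHS]mxE [RHS]mxE [X in _ + X]mxE [(h *m _) i j]mxE big_ord1.
by [].
Qed.

(** Computing h^T X costs 2 d m operations, and so does the update of X. *)
Lemma flops_crefl (d m : nat) (h : 'cV[R]_d) (X : 'M[R]_(d, m)) :
  (flops (crefl h X) <= 4 * d * m)%N.
Proof.
rewrite flops_bind.
apply: leq_trans (leq_add (flops_cmulmx _ _) (@flops_ctab_le _ _ _ 2 _ _)) _ => //.
by lia.
Qed.

Lemma value_crefls (d m : nat) (hs : seq 'cV[R]_d) (X : 'M[R]_(d, m)) :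
  value (crefls hs X) = (refls hs)^T *m X.
Proof.
elim: hs X => [|h hs IH] X; first by rewrite /= trmx1 mul1mx.
transitivity (value (crefls hs (value (crefl h X)))) => //.
by rewrite IH value_crefl /= trmx_mul refl_sym mulmxA.
Qed.

Lemma flops_crefls (d m : nat) (hs : seq 'cV[R]_d) (X : 'M[R]_(d, m)) :
  (flops (crefls hs X) <= size hs * (4 * d * m))%N.
Proof.
elim: hs X => [|h hs IH] X //.
by rewrite mulSn; apply: leq_add (flops_crefl _ _) (IH _).
Qed.

Lemma value_cmap (T S : Type) (f : T -> counted S) (s : seq T) :
  value (cmap f s) = [seq value (f x) | x <- s].
Proof. by elim: s => //= x s <-. Qed.

Lemma flops_cmap (T S : Type) (k : nat) (f : T -> counted S) (s : seq T) :
  (forall x, (flops (f x) <= k)%N) -> (flops (cmap f s) <= size s * k)%N.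
Proof.
move=> H; elim: s => // x s IH.
by rewrite [cmap _ _]/= !flops_bind addn0 mulSn leq_add.
Qed.

End Kernels.

(** * The Householder vector of a single elimination step *)

Section QR.
Variables (R : realType) (K : routines R).

(** The Householder direction before normalization, with the sign choice folded into the shift [s],
    which is the norm of the column part or its negative. *)
Definition house_dir (a m : nat) (W : 'M[R]_(a, m)) (j : 'I_m) (s : R) :
    'cV[R]_a :=
  \col_(i < a) (if (i < j)%N then 0
                else if (i == j :> nat) then ent W j j + s else W i j).

Lemma value_house (a m : nat) (W : 'M[R]_(a, m)) (j : 'I_m) (nu : R) :
  let alpha := Num.sqrt nu in
  let v := house_dir W j (if rsign K (ent W j j) alpha then alpha else - alpha) in
  value (house K W j nu) =
  (Num.sqrt 2 / Num.sqrt (\sum_(i < a) v i 0 ^+ 2)) *: v.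
Proof.
move=> alpha v; apply/matrixP=> i l; rewrite /house !value_bind ord1 !mxE /=.
congr (_ / Num.sqrt _ * _).
  by apply: eq_bigr => k _; rewrite !mxE -expr2; case: ifP => // _; case: ifP => // _; case: rsign.
by case: ifP => // _; case: ifP => // _; case: rsign.
Qed.

Lemma flops_house (a m : nat) (W : 'M[R]_(a, m)) (j : 'I_m) (nu : R) :
  (flops (house K W j nu) <= 3 * a + 6)%N.
Proof.
rewrite /house !flops_bind.
apply: (@leq_trans (1 + (1 + (1 + (a * 2 + (1 + (1 + (1 + a * 1 * 1))))))))%N.
  do 2![apply: leq_add; first by []].
  apply: leq_add; first by case: ifP.
  apply: leq_add; first exact: flops_csum_le.
  do 3![apply: leq_add; first by []].
  exact: flops_ctab_le.
by lia.
Qed.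

(** Let w be column [j] from row [j] on and v = w + s e_j with s^2 = |w|^2. Then |v|^2 = 2 v^T w, so
    the reflection along v maps w to w - v = - s e_j. *)
Lemma house_spec (a m : nat) (W : 'M[R]_(a, m)) (j : 'I_m) :
  let nu := \sum_(i < a) (if (j <= i)%N then W i j ^+ 2 else 0) in
  let y := value (house K W j nu) in
  (j < a)%N -> nu != 0 ->
  [/\ forall i : 'I_a, (i < j)%N -> y i 0 = 0, frob y = Num.sqrt 2 &
      exists2 beta, beta != 0 & forall i : 'I_a, (j <= i)%N ->
        (refl y *m W) i j = if (i == j :> nat) then beta else 0].
Proof.
move=> nu y ja nu0.
have nu_gt0 : 0 < nu.
  by rewrite lt_def nu0 sumr_ge0 // => i _; case: ifP => // _; apply: sqr_ge0.
set x := ent W j j; set alpha := Num.sqrt nu.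
have alpha_gt0 : 0 < alpha by rewrite sqrtr_gt0.
pose s := if rsign K x alpha then alpha else - alpha.
have ss : s ^+ 2 = nu by rewrite /s; case: ifP => _; rewrite ?sqrrN sqr_sqrtr ?ltW.
have s0 : s != 0 by rewrite -sqrf_eq0 ss.
(* The sign rule [rsignP] says precisely that x differs from - s. *)
have xs0 : x + s != 0.
  have := rsignP K x alpha_gt0; rewrite /s; case: rsign => /=.
    by rewrite expr1 mulN1r addr_eq0.
  by rewrite expr0 mul1r subr_eq0.
pose v := house_dir W j s.
have Ey : y = (Num.sqrt 2 / Num.sqrt (\sum_(i < a) v i 0 ^+ 2)) *: v.
  exact: value_house.
clearbody y; set v2 := \sum_(i < a) v i 0 ^+ 2 in Ey.
pose jj := Ordinal ja.
have Ex : x = W jj j by rewrite /x (ent_ord W jj j).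
have vjj : v jj 0 = x + s by rewrite mxE ltnn eqxx.
have vE (i : 'I_a) : (j < i)%N -> v i 0 = W i j.
  by move=> ji; rewrite mxE ltnNge (ltnW ji) /= gtn_eqF.
have vlow (i : 'I_a) : (i < j)%N -> v i 0 = 0 by move=> ij; rewrite mxE ij.
pose rest := \sum_(i < a | i != jj) (if (j <= i)%N then W i j ^+ 2 else 0).
have Enu : nu = x ^+ 2 + rest by rewrite /nu (bigD1 jj) //= leqnn Ex.
(* Below row [j] the vector v agrees with the column and above it v vanishes, so |v|^2 and v^T w
   have the same contribution off row [j] as [nu]. *)
have Hrest (F : 'I_a -> R) :
    (forall i : 'I_a, (i < j)%N -> F i = 0) ->
    (forall i : 'I_a, (j < i)%N -> F i = W i j ^+ 2) ->
    \sum_(i < a | i != jj) F i = rest.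
  move=> H1 H2; apply: eq_bigr => i ij; case: (ltngtP j i) => H; first exact: H2.
    exact: H1.
  by case/eqP: ij; apply: val_inj.
have Ev2 : v2 = (x + s) ^+ 2 + rest.
  rewrite /v2 (bigD1 jj) //= vjj; congr (_ + _); apply: Hrest => i ij.
    by rewrite vlow // expr0n.
  by rewrite vE.
have EvW : \sum_(i < a) v i 0 * W i j = (x + s) * x + rest.
  rewrite (bigD1 jj) //= vjj -Ex; congr (_ + _); apply: Hrest => i ij.
    by rewrite vlow // mul0r.
  by rewrite vE.
have rest_ge0 : 0 <= rest.
  by rewrite sumr_ge0 // => i _; case: ifP => // _; apply: sqr_ge0.
have v2_gt0 : 0 < v2.
  by rewrite Ev2 ltr_wpDr // lt_def sqrf_eq0 xs0 sqr_ge0.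
set c := Num.sqrt 2 / Num.sqrt v2 in Ey.
have cc : c ^+ 2 * v2 = 2.
  by rewrite /c expr_div_n !sqr_sqrtr ?ler0n ?ltW // divfK // gt_eqF.
split=> [i ij||].
- by rewrite Ey mxE vlow // mulr0.
- rewrite /frob; congr Num.sqrt; rewrite -cc /v2 mulr_sumr.
  by apply: eq_bigr => i _; rewrite big_ord1 Ey mxE exprMn.
(* In row [j] the reflected column has the entry x - (x + s). *)
exists (- s); first by rewrite oppr_eq0.
move=> i ji; rewrite refl_mul.
have -> : (W - y *m (y^T *m W)) i j = W i j - y i 0 * \sum_(l < a) y l 0 * W l j.
  rewrite !mxE big_ord1 mxE; congr (_ - _ * _).
  by apply: eq_bigr => l _; rewrite mxE.
have -> : \sum_(l < a) y l 0 * W l j = c * \sum_(l < a) v l 0 * W l j.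
  by rewrite mulr_sumr; apply: eq_bigr => l _; rewrite Ey mxE mulrA.
have -> : y i 0 * (c * \sum_(l < a) v l 0 * W l j) = v i 0.
  rewrite Ey mxE EvW.
  (* This is 2 v^T w = |v|^2, a consequence of s^2 = x^2 + [rest]. Hence c^2 v^T w = 1, and exactly
     v is subtracted from the column. *)
  have : 2 * ((x + s) * x + rest) = v2.
    by rewrite Ev2; move: ss; rewrite Enu => ss; ring: ss.
  move=> E; have {E} : c ^+ 2 * ((x + s) * x + rest) = 1 by rewrite -E in cc; lra.
  by move=> E; rewrite -[RHS]mulr1 -E; ring.
case: eqP => [ij|/eqP ij]; last first.
  by rewrite vE ?subrr // ltn_neqAle eq_sym ij.
have -> : i = jj by apply: val_inj.
by rewrite vjj -Ex; ring.
Qed.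

End QR.

(** * Column-pivoted QR decomposition: loop invariant, termination and cost *)

Section QRLoop.
Variables (R : realType) (K : routines R).

(** The loop invariant. It constrains the columns already reduced, as many as there are reflectors;
    their nonzero diagonal entries later give a lower bound for the rank. *)
Record partial_qr (a m : nat) (Z : 'M[R]_(a, m)) (F : qr_out R a m) : Prop :=
  PartialQr {
    pqrE : Z = refls (qrY F) *m qrW F *m qrP F;
    pqr_perm : orthogonal_mx (qrP F);
    pqr_norm : forall y, y \in qrY F -> frob y = Num.sqrt 2;
    pqr_low : forall (i : 'I_a) (c : 'I_m),
      (c < size (qrY F))%N -> (c < i)%N -> qrW F i c = 0;
    pqr_diag : forall (i : 'I_a) (c : 'I_m),
      (c < size (qrY F))%N -> i = c :> nat -> qrW F i c != 0 }.

(** The two swaps insert the square of a transposition between the factors, so column pivoting is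
    compensated by a row swap in the permutation. *)
Lemma xcol_mul_xrow (a b c : nat) (A : 'M[R]_(a, b)) (B : 'M[R]_(b, c))
  (i j : 'I_b) : xcol i j A *m xrow i j B = A *m B.
Proof.
rewrite xcolE xrowE -mulmxA (mulmxA (tperm_mx i j)) /tperm_mx -perm_mxM.
by rewrite tperm2 perm_mx1 mul1mx.
Qed.

Lemma partial_qr_step (a m : nat) (Z W : 'M[R]_(a, m)) (P : 'M[R]_m)
    (ys : seq 'cV[R]_a) (j c : 'I_m) :
  (m <= a)%N -> size ys = j -> (j <= c)%N ->
  let nu := \sum_(i < a) (if (j <= i)%N then W i c ^+ 2 else 0) in
  let y := value (house K (xcol j c W) j nu) in
  nu != 0 -> partial_qr Z (QrOut W P ys) ->
  partial_qr Z (QrOut (refl y *m xcol j c W) (xrow j c P) (rcons ys y)).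
Proof.
move=> ma sz jc nu y nu0 [/= EZ HP Hy Hlow Hdiag].
have Enu : nu = \sum_(i < a) (if (j <= i)%N then xcol j c W i j ^+ 2 else 0).
  by apply: eq_bigr => i _; rewrite !mxE tpermL.
have [||] := @house_spec _ K _ _ (xcol j c W) j.
- exact: leq_trans (ltn_ord j) ma.
- by rewrite -Enu.
rewrite -Enu -/y => ylow ynorm [beta beta0 Hbeta].
have Wcol (i : 'I_a) (x : 'I_m) : (x < j)%N -> xcol j c W i x = W i x.
  move=> xj; rewrite mxE tpermD //; apply: contraTneq xj => <-;
  by rewrite -leqNgt.
(* Reduced columns survive the new reflection: y vanishes above row [j] and these columns vanish
   from row [j] on, so y is orthogonal to them. *)
have W2col (i : 'I_a) (x : 'I_m) :
    (x < j)%N -> (refl y *m xcol j c W) i x = W i x.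
  move=> xj; rewrite refl_mul -(Wcol i x xj).
  rewrite mxE [X in _ + X]mxE [(y *m _) i x]mxE big_ord1.
  rewrite [(y^T *m _) 0 x]mxE big1 ?mulr0 ?subr0 // => l _; rewrite [y^T _ _]mxE.
  case: (ltnP l j) => lj; first by rewrite ylow // mul0r.
  by rewrite Wcol // Hlow ?mulr0 ?sz // (leq_trans xj).
have refl2 : refl y *m refl y = 1%:M.
  by rewrite -{1}refl_sym; apply: refl_orthogonal.
split=> /=.
- rewrite -cats1 refls_cat /= mulmx1 EZ -!mulmxA; congr (_ *m _).
  by rewrite !mulmxA refl2 mul1mx xcol_mul_xrow.
- rewrite /orthogonal_mx xrowE trmx_mul /tperm_mx tr_perm_mx tpermV -mulmxA.
  by rewrite (mulmxA (perm_mx _)) -perm_mxM tperm2 perm_mx1 mul1mx.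
- by move=> y'; rewrite mem_rcons inE => /predU1P[->|/Hy].
- move=> i x; rewrite size_rcons sz ltnS leq_eqVlt => /predU1P[xj xi|xj xi].
    have -> : x = j by apply: val_inj.
    by rewrite Hbeta -xj ?(ltnW xi) // gtn_eqF.
  by rewrite W2col // Hlow // sz.
- move=> i x; rewrite size_rcons sz ltnS leq_eqVlt => /predU1P[xj xi|xj xi].
    have -> : x = j by apply: val_inj.
    by rewrite Hbeta xi xj // eqxx.
  by rewrite W2col // Hdiag // sz.
Qed.

(** The table of squared norms from the body of [qr_loop], written identically so that it can be
    folded there. *)
Definition col_norms (a m : nat) (W : 'M[R]_(a, m)) (j : 'I_m) :
    counted 'rV[R]_m :=
  ctab (fun (_ : 'I_1) (c : 'I_m) =>
    if (j <= c)%N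
    then csum (fun i : 'I_a =>
           if (j <= i)%N then cmul (W i c) (W i c) else ret 0)
    else ret 0).

Lemma value_col_norms (a m : nat) (W : 'M[R]_(a, m)) (j c : 'I_m) :
  (j <= c)%N -> value (col_norms W j) 0 c =
  \sum_(i < a) (if (j <= i)%N then W i c ^+ 2 else 0).
Proof.
by move=> jc; rewrite mxE jc; apply: eq_bigr => i _; case: ifP.
Qed.

Lemma qr_loop_cons (a m : nat) (j : 'I_m) (js : seq 'I_m)
    (W : 'M[R]_(a, m)) (P : 'M[R]_m) (ys : seq 'cV[R]_a) :
  let nu := value (col_norms W j) in
  let c := pivot K j nu in
  let y := value (house K (xcol j c W) j (nu 0 c)) in
  value (qr_loop K (j :: js) W P ys) =
  if nu 0 c == 0 then QrOut W P ys else
  value (qr_loop K js (refl y *m xcol j c W) (xrow j c P) (rcons ys y)).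
Proof.
move=> nu c y; rewrite -value_crefl.
by rewrite [qr_loop _ (_ :: _) _ _ _]/= !value_bind /=; case: ifP.
Qed.

(** The condition on [iota] says that the columns still to be treated are consecutive and start at
    the number of reflectors found so far. *)
Lemma qr_loop_spec (a m : nat) (js : seq 'I_m) (Z W : 'M[R]_(a, m))
    (P : 'M[R]_m) (ys : seq 'cV[R]_a) :
  (m <= a)%N -> (size ys + size js = m)%N ->
  [seq val j | j <- js] = iota (size ys) (size js) ->
  partial_qr Z (QrOut W P ys) ->
  let F := value (qr_loop K js W P ys) in
  [/\ partial_qr Z F, (size (qrY F) <= m)%N &
      forall (i : 'I_a) (c : 'I_m), (size (qrY F) <= i)%N -> qrW F i c = 0].
Proof.
move=> ma; elim: js W P ys => [|j js IH] W P ys; last first.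
  move=> sz Ejs H; rewrite qr_loop_cons.
  have [jE jsE] : j = size ys :> nat /\
      [seq val i | i <- js] = iota (size ys).+1 (size js) by case: Ejs.
  set nu := value (col_norms W j); set c := pivot K j nu.
  have [jc cmax] := pivotP K j nu; rewrite -/c in jc cmax.
  case: eqP => [nu0|/eqP nu0]; last first.
    apply: IH.
    - by rewrite size_rcons addSnnS.
    - by rewrite jsE size_rcons.
    rewrite value_col_norms // in nu0 *.
    by apply: partial_qr_step.
  split=> // [|i x /= Hi]; first by rewrite -[X in (_ <= X)%N]sz leq_addr.
  have [xj|jx] := ltnP x j.
    by apply: (pqr_low H) => /=; rewrite -?jE // (leq_trans xj) // jE.
  (* Early exit: the largest of the remaining squared norms is 0, so every remaining column vanishes
     from row [j] on. *)
  have := cmax _ jx; rewrite nu0 value_col_norms // => le0.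
  have ge0 (l : 'I_a) : 0 <= (if (j <= l)%N then W l x ^+ 2 else 0).
    by case: ifP => // _; apply: sqr_ge0.
  have /eqP : \sum_(l < a) (if (j <= l)%N then W l x ^+ 2 else 0) = 0.
    by apply: le_anti; rewrite le0 sumr_ge0.
  rewrite psumr_eq0 // => /allP /(_ i (mem_index_enum i)) /=.
  by rewrite jE Hi sqrf_eq0 => /eqP.
(* With all [m] columns reduced, a row index of at least [m] exceeds every column index, and the
   zeros below the diagonal suffice. *)
rewrite addn0 => sz _ H; split=> //=; first by rewrite sz.
move=> i c; rewrite sz => Hi; apply: (pqr_low H) => /=; first by rewrite sz.
apply: leq_trans Hi; exact: ltn_ord.
Qed.

Lemma qrcp_spec (a m : nat) (Z : 'M[R]_(a, m)) :
  (m <= a)%N ->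
  let F := value (qrcp K Z) in
  [/\ partial_qr Z F, (size (qrY F) <= m)%N &
      forall (i : 'I_a) (c : 'I_m), (size (qrY F) <= i)%N -> qrW F i c = 0].
Proof.
move=> ma; apply: qr_loop_spec => //=.
- by rewrite add0n size_enum_ord.
- by rewrite val_enum_ord size_enum_ord.
- split=> //=; first by rewrite mul1mx mulmx1.
  exact: orthogonal1.
Qed.

Lemma flops_qr_loop (a m : nat) (js : seq 'I_m) (W : 'M[R]_(a, m))
    (P : 'M[R]_m) (ys : seq 'cV[R]_a) : (m <= a)%N ->
  (flops (qr_loop K js W P ys) <= size js * (17 * a * m))%N.
Proof.
move=> ma; elim: js W P ys => [|j js IH] W P ys //.
have m_gt0 : (0 < m)%N by apply: leq_ltn_trans (ltn_ord j).
rewrite [qr_loop _ _ _ _ _]/= !flops_bind (mulSn (size js)).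
have Hnu : (flops (col_norms W j) <= 1 * m * (a * 2))%N.
  apply: flops_ctab_le => _ c; case: ifP => // _.
  by apply: flops_csum_le => i; case: ifP.
rewrite -/(col_norms W j); set nu := value (col_norms W j).
(* Norms, pivot search, zero test, Householder vector and its application; as 1 <= m <= a, they
   amount to at most 2 + 1 + 1 + (3 + 6) + 4 = 17 times a m. *)
apply: (@leq_trans (1 * m * (a * 2) + (m + (1 + (3 * a + 6 +
  (4 * a * m + size js * (17 * a * m))))))); last first.
  have : (a <= a * m)%N by rewrite leq_pmulr.
  have : (m <= a * m)%N by rewrite leq_pmull // (leq_trans m_gt0).
  by move: (size js * _)%N => x; lia.
apply: leq_add => //; apply: leq_add; first by [].
apply: leq_add; first by [].
case: ifP => _; first by [].
rewrite !flops_bind; apply: leq_add; first exact: flops_house.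
by apply: leq_add; [exact: flops_crefl | exact: IH].
Qed.

Lemma flops_qrcp (a m : nat) (Z : 'M[R]_(a, m)) : (m <= a)%N ->
  (flops (qrcp K Z) <= 17 * a * m ^ 2)%N.
Proof.
move=> ma; apply: leq_trans (flops_qr_loop _ _ _ _ ma) _.
by rewrite size_enum_ord; lia.
Qed.

End QRLoop.

(** * The column shuffle and the factorization of the augmented matrix *)

Section Augment.
Variable R : realType.

Lemma ent_blk (a b i0 j0 a' b' : nat) (A : 'M[R]_(a', b')) (i j : nat) :
  (i < a)%N -> (j < b)%N ->
  ent (blk a b i0 j0 A) i j = ent A (i0 + i) (j0 + j).
Proof.
by move=> ia jb; rewrite (ent_ord _ (Ordinal ia) (Ordinal jb)) mxE.
Qed.

Lemma ent_block (a b c e : nat) (A : 'M[R]_(a, b)) (B : 'M[R]_(a, e))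
    (C : 'M[R]_(c, b)) (D : 'M[R]_(c, e)) (i j : nat) :
  ent (block_mx A B C D) i j =
  if (i < a)%N then (if (j < b)%N then ent A i j else ent B i (j - b))
  else (if (j < b)%N then ent C (i - a) j else ent D (i - a) (j - b)).
Proof.
case: (entP (block_mx A B C D)) => [i' j' -> ->|H].
  case: (split_ordP i') => k ->; case: (split_ordP j') => l -> /=.
  - by rewrite block_mxEul ent_ord.
  - by rewrite block_mxEur addKn ent_ord.
  - by rewrite block_mxEdl addKn ent_ord.
  - by rewrite block_mxEdr !addKn ent_ord.
by symmetry; case: ifP => ia; case: ifP => jb; apply: ent_out; lia.
Qed.

Lemma ent_diag (r : nat) (s : 'rV[R]_r) (i j : nat) :
  i != j -> ent (diag_mx s) i j = 0.
Proof.
case: (entP (diag_mx s)) => [i' j' -> -> ij|//].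
by rewrite mxE -val_eqE /= (negPf ij) mulr0n.
Qed.

(** Every column of the shuffle lives in one block of rows: it is a unit vector in the first [n]
    rows or a column of Q in the last [m]. *)
Lemma mul_shuffle (d n r m : nat) (X : 'M[R]_(d, n)) (Z : 'M[R]_(d, m))
    (Q : 'M[R]_m) (i : 'I_d) (j : 'I_(n + m)) : (r <= n)%N ->
  (row_mx X Z *m shuffle n r Q) i j =
  if (j < r)%N then ent X i j
  else if (j < r + m)%N then ent (Z *m Q) i (j - r)
  else ent X i (j - m).
Proof.
move=> rn; have jnm := ltn_ord j.
rewrite mxE big_split_ord /=.
under eq_bigr do rewrite row_mxEl mxE /=.
under [X in _ + X]eq_bigr do rewrite row_mxEr mxE /=.
have pick (k : nat) : (k < n)%N ->
    \sum_(l < n) X i l * ((l : nat) == k)%:R = ent X i k.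
  move=> kn; rewrite (bigD1 (Ordinal kn)) //= eqxx mulr1 big1 ?addr0.
    by rewrite -(ent_ord X).
  move=> l lk; rewrite (_ : (l : nat) == k = false) ?mulr0 //.
  by apply: contraNF lk => /eqP E; apply/eqP/val_inj.
case: ifP => jr.
  under eq_bigr do rewrite -val_eqE /=.
  rewrite pick ?(leq_trans jr) // [X in _ + X]big1 ?addr0 // => l _.
  rewrite -val_eqE /= gtn_eqF ?mulr0 //.
  by rewrite ltn_addr // (leq_trans jr).
have rj : (r <= j)%N by rewrite leqNgt jr.
case: ifP => jrm.
  rewrite big1 ?add0r => [|l _]; last by rewrite leqNgt ltn_ord mulr0.
  have jm : (j - r < m)%N by rewrite ltn_subLR.
  rewrite (ent_ord (Z *m Q) i (Ordinal jm)) mxE; apply: eq_bigr => l _.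
  by rewrite leq_addr addKn (ent_ord Q l (Ordinal jm)).
have rmj : (r + m <= j)%N by rewrite leqNgt jrm.
rewrite [X in _ + X]big1 ?addr0 => [|l _]; last first.
  rewrite -addnA gtn_eqF ?mulr0 //; lia.
rewrite -pick; last by lia.
by apply: eq_bigr => l _; congr (_ * _%:R); congr (nat_of_bool _); lia.
Qed.

Lemma shuffle_orthogonal (n r m : nat) (Q : 'M[R]_m) : (r <= n)%N ->
  orthogonal_mx Q -> orthogonal_mx (shuffle n r Q).
Proof.
(* Splitting S^T as [X Z] lets [mul_shuffle] evaluate S^T S entry by entry. *)
move=> rn HQ; apply/matrixP=> i j; rewrite -[X in X *m _]hsubmxK mul_shuffle //.
have im := ltn_ord i; have jm := ltn_ord j.
rewrite [RHS]mxE -val_eqE /=.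
case: ifP => jr.
  have jn : (j < n)%N by apply: leq_trans rn.
  rewrite (ent_ord _ i (Ordinal jn)) !mxE -!val_eqE /=.
  case: ifP => ir; first by rewrite eq_sym.
  case: ifP => irm; first by rewrite leqNgt jn /= (_ : i == j :> nat = false) //; lia.
  by congr (_%:R); congr (nat_of_bool _); lia.
case: ifP => jrm.
  have jrm' : (j - r < m)%N by lia.
  rewrite (ent_ord _ i (Ordinal jrm')) mxE.
  under eq_bigr do rewrite !mxE /=.
  have [ir|ri] := ltnP i r.
    rewrite big1 => [|l _]; last first.
      by rewrite -val_eqE /= gtn_eqF ?mul0r // ltn_addr // (leq_trans ir).
    by rewrite (_ : i == j :> nat = false) //; lia.
  have [irm|rmi] := ltnP i (r + m).
    have irm' : (i - r < m)%N by lia.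
    transitivity ((Q^T *m Q) (Ordinal irm') (Ordinal jrm')).
      rewrite mxE; apply: eq_bigr => l _.
      by rewrite leq_addr addKn (ent_ord _ l (Ordinal irm')) mxE.
    rewrite HQ mxE -val_eqE /=; congr (_%:R); congr (nat_of_bool _); lia.
  rewrite big1 => [|l _]; last by rewrite gtn_eqF ?mul0r //; lia.
  by rewrite (_ : i == j :> nat = false) //; lia.
have jn : (j - m < n)%N by lia.
rewrite (ent_ord _ i (Ordinal jn)) !mxE -!val_eqE /=.
case: ifP => ir; first by congr (_%:R); congr (nat_of_bool _); lia.
case: ifP => irm; first by rewrite leqNgt jn /= (_ : i == j :> nat = false) //; lia.
by congr (_%:R); congr (nat_of_bool _); lia.
Qed.

Lemma refls_lift (r a : nat) (ys : seq 'cV[R]_a) :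
  refls [seq col_mx (0 : 'cV[R]_r) y | y <- ys] = block_mx 1%:M 0 0 (refls ys).
Proof.
elim: ys => [|y ys IH] /=; first by rewrite -scalar_mx_block.
rewrite IH /refl tr_col_mx mul_col_row trmx0 !mul0mx !mulmx0.
rewrite [X in X - _](scalar_mx_block r a 1) opp_block_mx add_block_mx.
by rewrite !oppr0 !addr0 mulmx_block !mulmx0 !mul0mx !mul1mx !addr0 !add0r.
Qed.

Lemma blk_id (a b : nat) (A : 'M[R]_(a, b)) : blk a b 0 0 A = A.
Proof. by apply/matrixP=> i j; rewrite mxE ent_ord. Qed.

(** The lifted reflectors fix the first [r] rows, where both sides read [Sigma' Z_1 P^T 0]. In the
    last [a] rows, P P^T = I turns the QR decomposition into Z_2 P^T = refls(ys) W. *)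
Lemma augment_factor (d n r a m : nat) (s : 'rV[R]_r) (Z : 'M[R]_(d, m))
    (W : 'M[R]_(a, m)) (P : 'M[R]_m) (ys : seq 'cV[R]_a) :
  (r + a = d)%N -> (r <= n)%N -> orthogonal_mx P ->
  blk a m r 0 Z = refls ys *m W *m P ->
  (forall (i : 'I_a) (c : 'I_m), (m <= i)%N -> W i c = 0) ->
  row_mx (blk d n 0 0 (diag_mx s)) Z *m shuffle n r P^T =
  refls [seq blk d 1 0 0 (col_mx (0 : 'cV[R]_r) y) | y <- ys] *m
  blk d (n + m) 0 0
    (block_mx (diag_mx s) (blk r m 0 0 Z *m P^T) 0 (blk m m 0 0 W)).
Proof.
move=> Ed rn HP EZ HW; subst d.
under eq_map do rewrite blk_id.
rewrite refls_lift; apply/matrixP=> i j; rewrite mul_shuffle //.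
have jnm := ltn_ord j.
set T := block_mx (diag_mx s) _ _ _.
have Etop (k : 'I_r) : (block_mx 1%:M 0 0 (refls ys) *m
    blk (r + a) (n + m) 0 0 T) (lshift a k) j = ent T k j.
  rewrite -[X in _ *m X]vsubmxK mul_block_col col_mxEu mul1mx mul0mx addr0.
  by rewrite !mxE.
have Ebot (k : 'I_a) : (block_mx 1%:M 0 0 (refls ys) *m
    blk (r + a) (n + m) 0 0 T) (rshift r k) j =
    \sum_(l < a) refls ys k l * ent T (r + l) j.
  rewrite -[X in _ *m X]vsubmxK mul_block_col col_mxEd mul0mx add0r mxE.
  by apply: eq_bigr => l _; rewrite !mxE.
have EZP (k : nat) (l : nat) : (k < a)%N -> (l < m)%N ->
    ent (Z *m P^T) (r + k) l = ent (refls ys *m W) k l.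
  move=> ka lm; have -> : refls ys *m W = blk a m r 0 Z *m P^T.
    by rewrite EZ -[RHS]mulmxA (mulmx1C HP) mulmx1.
  rewrite (ent_ord _ (rshift r (Ordinal ka)) (Ordinal lm)).
  rewrite (ent_ord _ (Ordinal ka) (Ordinal lm)) !mxE.
  by apply: eq_bigr => x _; rewrite [blk _ _ _ _ _ _ _]mxE /= (ent_ord Z (rshift r (Ordinal ka))).
case: (split_ordP i) => k ->; rewrite ?Etop ?Ebot.
  have kr := ltn_ord k.
  rewrite ent_block kr /=; case: ifP => jr.
    by rewrite ent_blk ?(leq_trans jr) // (ltn_addr _ kr).
  case: ifP => jrm.
    have jm : (j - r < m)%N by lia.
    rewrite (ent_ord (Z *m P^T) (lshift a k) (Ordinal jm)).
    rewrite (ent_ord _ k (Ordinal jm)) !mxE; apply: eq_bigr => x _.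
    by rewrite [blk _ _ _ _ _ _ _]mxE /= (ent_ord Z (lshift a k)).
  rewrite [RHS]ent_out ?orbT; last by lia.
  rewrite ent_blk ?(ltn_addr _ kr) //; last by lia.
  by rewrite ent_out //; lia.
under eq_bigr do rewrite ent_block ltnNge leq_addr addKn /=.
have ka := ltn_ord k.
case: ifP => jr.
  rewrite big1 => [|l _]; last first.
    by case: (entP (0 : 'M[R]_(m, r))) => [? ? _ _|_]; rewrite ?mxE mulr0.
  by rewrite ent_blk ?ltn_add2l ?(leq_trans jr) // ent_out // leq_addr.
case: ifP => jrm.
  have jm : (j - r < m)%N by lia.
  rewrite EZP // (ent_ord _ k (Ordinal jm)) mxE; apply: eq_bigr => l _.
  (* Cutting W down to its top [m] rows loses nothing, because the other rows are zero. *)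
  congr (_ * _); have [lm|ml] := ltnP l m; last first.
    by rewrite HW // ent_out // ml.
  by rewrite ent_blk // (ent_ord W l (Ordinal jm)).
rewrite big1 => [|l _]; last by rewrite ent_out ?mulr0 //; lia.
by rewrite ent_blk ?ltn_add2l ?ent_out //; lia.
Qed.

End Augment.

(** * Rank estimates, and correctness of one step with thresholding *)

Section Step.
Variables (R : realType) (K : routines R).

Lemma card_ord_lt (N k : nat) : (k <= N)%N ->
  #|[pred i : 'I_N | (i < k)%N]| = k.
Proof.
move=> kN; rewrite -sum1_card (eq_bigl (fun i : 'I_N => (i < k)%N)) //.
by rewrite -(big_ord_widen _ (fun=> 1%N) kN) sum_nat_const card_ord muln1.
Qed.

(** Converts the number of positive singular values into a position in the sorted list. A member j
    brings all of 0, ..., j with it, while a non-member confines the set to indices below j. *)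
Lemma card_initial (N : nat) (p : pred 'I_N) :
  (forall i j : 'I_N, (i <= j)%N -> p j -> p i) ->
  forall j, p j = (j < #|p|)%N.
Proof.
move=> Hp j; case: (boolP (p j)) => pj; apply/esym.
  have : [pred i : 'I_N | (i < j.+1)%N] \subset p.
    by apply/subsetP => i; rewrite !inE ltnS => ij; apply: Hp pj.
  by move/subset_leq_card; rewrite card_ord_lt.
have : p \subset [pred i : 'I_N | (i < j)%N].
  apply/subsetP => i pi; rewrite inE ltnNge.
  by apply: contra pj => ji; apply: Hp pi.
move/subset_leq_card; rewrite (card_ord_lt (ltnW (ltn_ord j))) => H.
by apply/negbTE; rewrite -leqNgt.
Qed.

(** The leading block of order [k] is triangular with nonzero diagonal, hence invertible, and it is
    obtained from T by multiplications on both sides. *)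
Lemma rank_triangular (N k : nat) (T : 'M[R]_N) : (k <= N)%N ->
  (forall i j : 'I_N, (j < i)%N -> T i j = 0) ->
  (forall i : 'I_N, (i < k)%N -> T i i != 0) -> (k <= \rank T)%N.
Proof.
move=> kN; move: T; rewrite -(subnKC kN); move: (N - k)%N => c T Hlow Hdiag.
have Eul : ulsubmx T = row_mx 1%:M 0 *m T *m col_mx 1%:M 0.
  rewrite -[in RHS](submxK T) mul_row_block !mul1mx !mul0mx !addr0.
  by rewrite mul_row_col mulmx1 mulmx0 addr0.
have Htrig : is_trig_mx (ulsubmx T)^T.
  by apply/is_trig_mxP => i j ij; rewrite !mxE Hlow.
have U : ulsubmx T \in unitmx.
  rewrite -unitmx_tr unitmxE det_trig // unitfE; apply/prodf_neq0 => i _.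
  by rewrite !mxE Hdiag //= ltn_ord.
rewrite -[X in (X <= _)%N](mxrank_unit U) Eul.
by apply: leq_trans (mxrankM_maxl _ _) (mxrankM_maxr _ _).
Qed.

Lemma rank_diag_initial (N k : nat) (s : 'rV[R]_N) : (k <= N)%N ->
  (forall j : 'I_N, (k <= j)%N -> s 0 j = 0) -> (\rank (diag_mx s) <= k)%N.
Proof.
move=> kN Hs; have -> : diag_mx s = pid_mx k *m diag_mx s :> 'M_N.
  apply/matrixP=> i j; rewrite mul_mx_diag !mxE val_eqE.
  case: eqP => [->|_]; last by rewrite mulr0n mul0r.
  rewrite /= mulr1n; case: ltnP => jk; first by rewrite mul1r.
  by rewrite mulr0n mul0r Hs.
by apply: leq_trans (mxrankM_maxl _ _) _; rewrite rank_pid_mx.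
Qed.

(** Storing only the positive singular values leaves the padded matrix Sigma unchanged. *)
Lemma blk_diag_initial (d n N k : nat) (s : 'rV[R]_N) : (k <= N)%N ->
  (forall j : 'I_N, (k <= j)%N -> s 0 j = 0) ->
  blk d n 0 0 (diag_mx (blk 1 k 0 0 s)) = blk d n 0 0 (diag_mx s).
Proof.
move=> kN Hs; apply/matrixP=> i j; rewrite !mxE !add0n.
have [Eij|ij] := eqVneq (i : nat) j; last by rewrite !ent_diag.
rewrite -Eij; have [ik|ki] := ltnP i k.
  have iN := leq_trans ik kN.
  rewrite (ent_ord _ (Ordinal ik) (Ordinal ik)).
  rewrite (ent_ord _ (Ordinal iN) (Ordinal iN)) !mxE !eqxx !mulr1n add0n /=.
  by rewrite (ent_ord s 0 (Ordinal iN)).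
rewrite ent_out ?ki //; case: (entP (diag_mx s)) => // i' j' Ei Ej.
have -> : j' = i' by apply: val_inj; rewrite /= -Ei -Ej.
by rewrite mxE eqxx mulr1n Hs // -Ei.
Qed.

Lemma blk_sub (a b c e : nat) (A B : 'M[R]_(a, b)) :
  blk c e 0 0 (A - B) = blk c e 0 0 A - blk c e 0 0 B.
Proof.
apply/matrixP=> i j; rewrite !mxE; case: (entP (A - B)) => [i' j' -> ->|H].
  by rewrite !ent_ord !mxE.
by rewrite !ent_out ?subr0.
Qed.

Lemma blk0 (a b c e : nat) : blk c e 0 0 (0 : 'M[R]_(a, b)) = 0.
Proof. by rewrite -[X in blk _ _ _ _ X](subrr 0) blk_sub subrr. Qed.

Lemma frob_lift (d r a : nat) (y : 'cV[R]_a) : (r + a = d)%N ->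
  frob y = Num.sqrt 2 ->
  frob (blk d 1 0 0 (col_mx (0 : 'cV[R]_r) y)) = Num.sqrt 2.
Proof.
move=> <-; rewrite blk_id => /frob_sqrt2P Ey; apply/frob_sqrt2P.
by rewrite tr_col_mx mul_row_col mulmx0 add0r.
Qed.

(** The first [r] diagonal entries come from the positive [s], the next ones from the reduced
    columns of the QR decomposition; beyond the number of reflectors the rows of [qrW F] vanish. *)
Lemma augmented_triangular (r m a : nat) (s : 'rV[R]_r) (X : 'M[R]_(r, m))
    (Z : 'M[R]_(a, m)) (F : qr_out R a m) :
  let T := block_mx (diag_mx s) X 0 (blk m m 0 0 (qrW F)) in
  let k := (r + size (qrY F))%N in
  (m <= a)%N -> (forall i, 0 < s 0 i) -> partial_qr Z F ->
  (forall (i : 'I_a) (c : 'I_m), (size (qrY F) <= i)%N -> qrW F i c = 0) ->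
  [/\ forall i j : 'I_(r + m), (j < i)%N -> T i j = 0,
      forall i j : 'I_(r + m), (k <= i)%N -> T i j = 0 &
      forall i : 'I_(r + m), (i < k)%N -> T i i != 0].
Proof.
move=> T k ma s_gt0 [_ _ _ Hlow Hdiag] Hz.
have EW (i j : 'I_m) : T (rshift r i) (rshift r j) = qrW F (widen_ord ma i) j.
  by rewrite block_mxEdr mxE -ent_ord.
split=> [i j|i j|i]; case: (split_ordP i) => i' -> /=;
  try case: (split_ordP j) => j' -> /=.
- move=> ji; rewrite block_mxEul mxE -val_eqE /= gtn_eqF //.
- by move=> ji; have := ltn_ord i'; lia.
- by move=> ji; rewrite block_mxEdl mxE.
- rewrite ltn_add2l EW => ji.
  have [jk|kj] := ltnP j' (size (qrY F)); first exact: Hlow.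
  by apply: Hz => /=; lia.
- by rewrite /k => ki; have := ltn_ord i'; lia.
- by rewrite /k => ki; have := ltn_ord i'; lia.
- by move=> ki; rewrite block_mxEdl mxE.
- by rewrite /k leq_add2l EW => ki; apply: Hz.
- by move=> _; rewrite block_mxEul mxE eqxx mulr1n gt_eqF.
- by rewrite /k ltn_add2l EW => ki; apply: Hdiag.
Qed.

(** The induction step for [run_spec]. The last inequality says that the number of reflectors grows
    by no more than the rank, written additively to avoid truncated subtraction. *)
Lemma step_spec (csvd : nat) (tau : R) (d n m : nat) (D : decomp R d n)
    (B : 'M[R]_(d, m)) :
  (n + m <= d)%N -> 0 <= tau -> well_formed D -> orthogonal_mx (Vm D) ->
  let S := value (step K csvd tau D B) in
  let D' := so_D S in
  [/\ well_formed D', orthogonal_mx (Vm D'),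
      (size (hs D') <= size (hs D) + m)%N,
      row_mx (U_of D *m Sigma_of D *m (Vm D)^T) B =
        U_of D' *m Sigma_of D' *m (Vm D')^T + so_E S &
      tau = 0 -> so_E S = 0 /\ (rk D + size (hs D') <= rk D' + size (hs D))%N].
Proof.
move=> nmd tau_ge0 [[rn usn] sg_gt0 UtO hsN] VO.
pose r := rk D; pose N := (r + m)%N; pose U := U_of D.
pose Z := value (crefls (hs D) (value (cmultop (Ut D)^T B))).
pose F := value (qrcp K (blk (d - r) m r 0 Z)); pose P := qrP F.
pose gs := [seq blk d 1 0 0 (col_mx (0 : 'cV[R]_r) y) | y <- qrY F].
pose ZP := value (cmulmx (blk r m 0 0 Z) P^T).
pose T0 : 'M[R]_N := block_mx (diag_mx (sg D)) ZP 0 (blk m m 0 0 (qrW F)).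
pose small := \matrix_(i < 1, j < N) (`|T0 j j| <=
  Num.sqrt (2 / ((N - j)%N%:R * (N - j + 1)%N%:R)) * tau).
pose mm := find (fun j : 'I_N => small 0 j) (enum 'I_N).
pose T : 'M[R]_N := \matrix_(i, j)
  if (mm <= i)%N && (mm <= j)%N then 0 else T0 i j.
pose o := svd K T.
pose drop := \matrix_(i < 1, j < N) (svdS o 0 j < tau).
pose s : 'rV[R]_N := \row_j (if drop 0 j then 0 else svdS o 0 j).
pose r' := #|[pred j | 0 < s 0 j]|.
pose w := maxn (us D) N.
pose S := shuffle n r P^T.
pose VS := value (cmulmx (padI (n + m) (Vm D)) S).
pose T1 := svdU o *m diag_mx s *m (svdV o)^T.
pose V' := value (cmulmx VS (padI (n + m) (svdV o))).
pose Ut' := value (cmulmx (padI w (Ut D)) (padI w (svdU o))).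
pose hs' := value (cmap (cmultop (svdU o)^T) (hs D ++ gs)).
(* The names above follow the body of [step], so both sides are convertible once the operation
   counts are projected away. *)
have -> : value (step K csvd tau D B) =
    StepOut (Decomp (blk 1 r' 0 0 s) V' Ut' hs')
      (U *m refls gs *m blk d (n + m) 0 0 (T0 - T1)
         *m (padI (n + m) (Vm D) *m S)^T) by [].
have usd : (us D <= d)%N by lia.
have Nd : (N <= d)%N by rewrite /N /r; lia.
have Nnm : (N <= n + m)%N by rewrite /N /r; lia.
have UO : orthogonal_mx U.
  by apply: orthogonal_mul; [apply: padI_orthogonal | apply: refls_orthogonal].
have EZ : Z = U^T *m B.
  by rewrite /Z value_crefls value_cmultop // -padI_tr mulmxA -trmx_mul.
have EZP : ZP = blk r m 0 0 Z *m P^T by apply: value_cmulmx.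
have EVS : VS = padI (n + m) (Vm D) *m S by apply: value_cmulmx.
have EV' : V' = VS *m padI (n + m) (svdV o) by apply: value_cmulmx.
have EUt' : Ut' = padI w (Ut D) *m padI w (svdU o) by apply: value_cmulmx.
have Ehs' : hs' = [seq padI d (svdU o)^T *m h | h <- hs D ++ gs].
  by rewrite /hs' value_cmap; apply: eq_map => h; rewrite value_cmultop.
have ma : (m <= d - r)%N by rewrite /r; lia.
have [HF sizeF zeroF] : [/\ partial_qr (blk (d - r) m r 0 Z) F,
    (size (qrY F) <= m)%N & forall (i : 'I_(d - r)) (c : 'I_m),
      (size (qrY F) <= i)%N -> qrW F i c = 0] by apply: qrcp_spec.
clearbody Z ZP F VS V' Ut' hs'.
have [T0low T0zero T0diag] : [/\
      forall i j : 'I_N, (j < i)%N -> T0 i j = 0,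
      forall i j : 'I_N, (r + size (qrY F) <= i)%N -> T0 i j = 0 &
      forall i : 'I_N, (i < r + size (qrY F))%N -> T0 i i != 0].
  by apply: (augmented_triangular ZP ma sg_gt0 HF zeroF).
have [oU oV S_ge0 S_mono ET] : is_svd T o.
  by apply: svdP => i j ji; rewrite mxE T0low // if_same.
have s_ge0 j : 0 <= s 0 j by rewrite mxE; case: ifP.
(* Zeroing the values below [tau] keeps the order, since a value that is kept is preceded only by
   values that are kept. *)
have s_mono (i j : 'I_N) : (i <= j)%N -> s 0 j <= s 0 i.
  move=> ij; have Sij := S_mono _ _ ij; rewrite !mxE; case: ltP => Sj.
    by case: ifP.
  by rewrite ltNge (le_trans Sj Sij).
have s_pos j : (0 < s 0 j) = (j < r')%N.
  apply: (@card_initial _ [pred j | 0 < s 0 j]) => i j' ij /= sj'.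
  exact: lt_le_trans (s_mono _ _ ij).
have r'N : (r' <= N)%N by rewrite -[X in (_ <= X)%N]card_ord max_card.
have s_zero (j : 'I_N) : (r' <= j)%N -> s 0 j = 0.
  by move=> r'j; apply: le_anti; rewrite s_ge0 leNgt s_pos -leqNgt r'j.
have PO : orthogonal_mx P by apply: pqr_perm HF.
have VSO : orthogonal_mx (padI (n + m) (Vm D) *m S).
  apply: orthogonal_mul; first by apply: padI_orthogonal; rewrite ?leq_addr.
  by apply: shuffle_orthogonal => //; apply: orthogonal_tr.
have gsN h : h \in gs -> frob h = Num.sqrt 2.
  case/mapP=> y /(pqr_norm HF) yN ->; apply: frob_lift yN.
  by rewrite /r; lia.
have padUO : orthogonal_mx (padI d (svdU o)) by apply: padI_orthogonal.
split=> /=.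
- split=> /=.
  + by split; rewrite ?geq_max; lia.
  + move=> i; have iN := leq_trans (ltn_ord i) r'N.
    by rewrite mxE (ent_ord s 0 (Ordinal iN)) s_pos /= ltn_ord.
  + rewrite EUt'; apply: orthogonal_mul; apply: padI_orthogonal => //.
      exact: leq_maxl.
    exact: leq_maxr.
  + move=> h; rewrite Ehs' => /mapP[h' h'in ->]; rewrite -padI_tr.
    apply: frob_mul_orthogonal; first exact: orthogonal_tr.
    by move: h'in; rewrite mem_cat => /orP[/hsN|/gsN].
- by rewrite EV' EVS; apply: orthogonal_mul => //; apply: padI_orthogonal.
- by rewrite Ehs' size_map size_cat leq_add2l size_map.
(* The stored data represent U refls(gs) times the padded SVD factor; [refls_conj] moves that factor
   to the left, into [Ut']. *)
- have EU' : padI d Ut' *m refls hs' = U *m refls gs *m padI d (svdU o).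
    rewrite Ehs' -padI_tr EUt' padI_mul ?geq_max ?usd //.
    rewrite !padI_padI ?leq_maxl ?leq_maxr ?geq_max ?usd //.
    by rewrite -mulmxA refls_conj // refls_cat !mulmxA.
  rewrite /U_of /Sigma_of /= EU' blk_diag_initial // EV' trmx_mul padI_tr EVS.
  have ET1 : padI d (svdU o) *m blk d (n + m) 0 0 (diag_mx s) *m
      padI (n + m) (svdV o)^T = blk d (n + m) 0 0 T1.
    by rewrite padI_mul_blk // blk_mul_padI.
  have -> X Y : X *m padI d (svdU o) *m blk d (n + m) 0 0 (diag_mx s) *m
      (padI (n + m) (svdV o)^T *m Y) =
      X *m blk d (n + m) 0 0 T1 *m Y :> 'M_(d, n + m).
    by rewrite -ET1 !mulmxA.
  (* The perturbation has the same outer factors, so the middle ones add up to T1 + (T0 - T1) =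
     T0. *)
  rewrite -mulmxDl -mulmxDr blk_sub addrC subrK.
  have -> : row_mx (U_of D *m Sigma_of D *m (Vm D)^T) B =
      U *m row_mx (Sigma_of D) Z *m (padI (n + m) (Vm D))^T.
    rewrite padI_block tr_block_mx !trmx0 trmx1 -[RHS]mulmxA mul_row_block.
    rewrite !mulmx0 mulmx1 addr0 add0r mul_mx_row EZ orthogonalK //.
    by rewrite mulmxA.
  have E : row_mx (Sigma_of D) Z *m S = refls gs *m blk d (n + m) 0 0 T0.
    rewrite /T0 EZP; apply: augment_factor => //; first by rewrite /r; lia.
      exact: pqrE HF.
    by move=> i c mi; apply: zeroF; apply: leq_trans mi.
  have SO : orthogonal_mx S.
    by apply: shuffle_orthogonal => //; apply: orthogonal_tr.
  rewrite -[in RHS](mulmxA U) -E trmx_mul !mulmxA.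
  by rewrite -(mulmxA _ S) (mulmx1C SO) mulmx1.
move=> tau0.
have Es : s = svdS o.
  by apply/rowP=> j; rewrite !mxE tau0 ltNge S_ge0.
have ETT : T = T0.
  apply/matrixP=> i j; rewrite mxE; case: ifP => // /andP[mi mj].
  have Hmm : (mm < N)%N by apply: leq_ltn_trans (ltn_ord i).
  have : has (fun j : 'I_N => small 0 j) (enum 'I_N).
    by rewrite has_find size_enum_ord.
  (* For zero threshold the entry found at position [mm] is a vanishing diagonal entry. Here [i]
     only serves as the default of [nth], as mm < N. *)
  move/(nth_find i); rewrite mxE tau0 mulr0 normr_le0 => /eqP T0mm.
  rewrite T0zero //; apply: leq_trans mi; rewrite leqNgt.
  apply/negP => mmk; have := T0diag (nth i (enum 'I_N) mm).
  by rewrite T0mm eqxx nth_enum_ord // => /(_ mmk).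
split; first by rewrite /T1 Es -ET ETT subrr blk0 mulmx0 mul0mx.
rewrite Ehs' size_map size_cat size_map addnCA [(r' + _)%N]addnC leq_add2l.
have kN : (r + size (qrY F) <= N)%N by rewrite /N leq_add2l.
(* With p new reflectors, r + p <= rank T0 = rank (U diag(s) V^T) <= rank diag(s) <= r'. *)
apply: leq_trans (rank_triangular kN T0low T0diag) _.
rewrite -ETT ET -Es; apply: leq_trans (mxrankM_maxl _ _) _.
apply: leq_trans (mxrankM_maxr _ _) _; exact: rank_diag_initial.
Qed.

End Step.

(** * Cost and storage bounds, and the induction over the steps *)

Section Run.
Variables (R : realType) (K : routines R).

(** Only the reflections of [B] and the pivoted QR decomposition touch all [d] rows; everything else
    works in order at most n + m and is at most cubic in it. *)
Lemma flops_step (csvd : nat) (tau : R) (d n m : nat) (D : decomp R d n)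
    (B : 'M[R]_(d, m)) :
  (n + m <= d)%N -> (0 < m)%N -> (rk D <= n)%N -> (us D <= n)%N ->
  (size (hs D) <= n)%N ->
  (flops (step K csvd tau D B)
     <= (csvd + 20) * ((n + m) ^ 3 + d * m * (size (hs D) + m)))%N.
Proof.
move=> nmd m_gt0 rn usn qn.
set q := size (hs D) in qn *; set M := (n + m)%N.
have usd : (us D <= d)%N by lia.
have ma : (m <= d - rk D)%N by lia.
have NM : (rk D + m <= M)%N by rewrite leq_add2r.
have wM : (maxn (us D) (rk D + m) <= M)%N by rewrite geq_max; lia.
have cube (x y z : nat) : (x <= M -> y <= M -> z <= M -> x * y * z <= M ^ 3)%N.
  by move=> xM yM zM; rewrite !expnS expn0 muln1 mulnA !leq_mul.
have M3 : (M <= M ^ 3)%N by rewrite -[X in (X <= _)%N]expn1 leq_pexp2l // /M; lia.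
(* One summand per operation of [step], in order. The multiples of M^3 add up to [csvd] + 20, which
   also dominates the 4 of the reflections and the 17 of the QR decomposition. *)
apply: (@leq_trans (2 * M ^ 3 + (q * (4 * d * m) + (17 * (d - rk D) * m ^ 2 +
  (2 * M ^ 3 + (6 * M ^ 3 + (csvd * M ^ 3 + (M ^ 3 + (M ^ 3 + (2 * M ^ 3 +
  (2 * M ^ 3 + (2 * M ^ 3 + (2 * M ^ 3 + 0)))))))))))))%N; last first.
  have : (17 * (d - rk D) * m ^ 2 <= 17 * (d * m * m))%N.
    by rewrite -!mulnA leq_mul2l leq_mul // leq_subr.
  have : (q * (4 * d * m) <= 4 * (d * m * q))%N by lia.
  rewrite mulnDr mulnDl [in X in (_ <= _ + X)%N]mulnDl mulnDr.
  move: (d * m * m)%N (d * m * q)%N (17 * _ * _)%N (q * _)%N (M ^ 3)%N.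
  by move=> *; nia.
rewrite /step; cbv zeta; rewrite flops_bind.
apply: leq_add.
  apply: leq_trans (flops_cmultop _ _ usd) _.
  by rewrite mulnA [leqRHS]mulnC leq_mul2r cube //; lia.
rewrite flops_bind; apply: leq_add; first exact: flops_crefls.
rewrite flops_bind; apply: leq_add; first exact: flops_qrcp.
rewrite flops_bind; apply: leq_add.
  apply: leq_trans (flops_cmulmx _ _) _.
  by rewrite mulnA [leqRHS]mulnC leq_mul2r cube //; lia.
rewrite flops_bind; apply: leq_add.
  apply: (@leq_trans (1 * (rk D + m) * 6)); first exact: flops_ctab_le.
  by rewrite mul1n mulnC leq_mul2l (leq_trans NM).
rewrite flops_bind; apply: leq_add.
  by rewrite leq_mul2l leq_exp2r ?NM ?orbT.
rewrite flops_bind; apply: leq_add.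
  apply: (@leq_trans (1 * (rk D + m) * 1)); first exact: flops_ctab_le.
  by rewrite mul1n muln1 (leq_trans NM).
rewrite flops_bind; apply: leq_add; first exact: leq_trans M3.
rewrite flops_bind; apply: leq_add.
  apply: leq_trans (flops_cmulmx _ _) _.
  by rewrite mulnA [leqRHS]mulnC leq_mul2r cube.
rewrite flops_bind; apply: leq_add.
  apply: leq_trans (flops_cmulmx _ _) _.
  by rewrite mulnA [leqRHS]mulnC leq_mul2r cube.
rewrite flops_bind; apply: leq_add.
  apply: leq_trans (flops_cmulmx _ _) _.
  by rewrite mulnA [leqRHS]mulnC leq_mul2r cube.
rewrite flops_bind; apply: leq_add => //.
(* At most n + m vectors are stored, by the bound on [size (hs D)], and each is multiplied by a
   matrix of order at most M. *)
apply: leq_trans.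
  apply: flops_cmap => h; apply: flops_cmultop; lia.
rewrite size_cat size_map muln1 mulnA mulnA [leqRHS]mulnC leq_mul2r /=.
apply: cube => //; rewrite leq_add //.
by case: (qrcp_spec K (blk (d - rk D) m (rk D) 0
  (value (crefls (hs D) (value (cmultop (Ut D)^T B))))) ma).
Qed.

Lemma U_of_orthogonal (d n : nat) (D : decomp R d n) :
  (n <= d)%N -> well_formed D -> orthogonal_mx (U_of D).
Proof.
move=> nd [[_ usn] _ UtO hsN]; apply: orthogonal_mul.
  by apply: padI_orthogonal => //; apply: leq_trans nd.
exact: refls_orthogonal.
Qed.

Lemma Sigma_of_ge0 (d n : nat) (D : decomp R d n) (i : 'I_d) (j : 'I_n) :
  well_formed D -> 0 <= Sigma_of D i j.
Proof.
move=> [_ sg_gt0 _ _]; rewrite mxE.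
case: (entP (diag_mx (sg D))) => // i' j' _ _; rewrite mxE.
by case: eqP => // _; rewrite mulr1n ltW.
Qed.

Lemma Sigma_of_diag (d n : nat) (D : decomp R d n) (i : 'I_d) (j : 'I_n) :
  (i : nat) <> j -> Sigma_of D i j = 0.
Proof. by move=> /eqP ij; rewrite mxE ent_diag. Qed.

(** The diagonal and the two orthogonal factors take at most n^2 numbers each, whence the 3. *)
Lemma storage_le (d n : nat) (D : decomp R d n) :
  (0 < n)%N -> well_formed D ->
  (storage D <= 3 * (n ^ 2 + size (hs D) * d))%N.
Proof.
move=> n0 [[rn usn] _ _ _]; rewrite /storage.
have : (us D ^ 2 <= n ^ 2)%N by rewrite leq_exp2r.
have : (n <= n ^ 2)%N by rewrite -[X in (X <= _)%N]expn1 leq_pexp2l.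
by move: (us D ^ 2)%N (n ^ 2)%N => *; nia.
Qed.

Variables (csvd d : nat) (m : nat -> nat) (A1 h1 : 'cV[R]_d).
Variables (B : forall k, 'M[R]_(d, m k)) (tau : R).
Hypotheses (A1_neq0 : A1 != 0) (tau_ge0 : 0 <= tau) (h1N : frob h1 = Num.sqrt 2).
Hypothesis (h1A : refl h1 *m A1 = frob A1 *: e1 R d).

Lemma dimn_gt0 k : (0 < dimn m k)%N.
Proof. by elim: k => //= k IH; rewrite ltn_addr. Qed.

(** The bound of the number of reflectors by [dimn m k] holds for every threshold and feeds
    [flops_step]; the sharper comparison with the rank is carried for [tau] = 0. *)
Lemma run_spec (k : nat) : (dimn m k <= d)%N ->
  let D := run K csvd tau A1 h1 B k in
  let E := perturbation K csvd tau A1 h1 B k in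
  [/\ well_formed D, orthogonal_mx (Vm D), (size (hs D) <= dimn m k)%N,
      Amat A1 B k = U_of D *m Sigma_of D *m (Vm D)^T + E &
      tau = 0 -> E = 0 /\ (size (hs D) <= rk D)%N].
Proof.
elim: k => [d_gt0|k IH nd]; [rewrite /=|move=> D E].
  split=> //; last 2 first.
  - exact: orthogonal1.
  - rewrite addr0 trmx1 mulmx1 /U_of padI1 mul1mx /= mulmx1.
    have -> : Sigma_of (init A1 h1) = frob A1 *: e1 R d.
      apply/matrixP=> i j; rewrite !mxE ord1 /=.
      case: (entP (diag_mx _)) => [i' j' Ei _|].
        by rewrite !ord1 add0n in Ei *; rewrite !mxE Ei mulr1n mulr1.
      by rewrite orbF => i0; rewrite gtn_eqF // mulr0.
    (* The first reflection is an involution, so it maps |A_1| e_1 back to A_1. *)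
    by rewrite -h1A mulmxA -{1}refl_sym refl_orthogonal // mul1mx.
  split=> //=; last 2 first.
  - exact: orthogonal1.
  - by move=> h; rewrite inE => /eqP ->.
  move=> i; rewrite mxE /frob sqrtr_gt0 lt_def sumr_ge0 ?andbT => [|x _]; last first.
    by apply: sumr_ge0 => y _; apply: sqr_ge0.
  apply: contraNneq A1_neq0 => A0; apply/eqP/matrixP=> x y; rewrite mxE.
  move: A0 => /eqP; rewrite psumr_eq0 => [|x' _]; last first.
    by apply: sumr_ge0 => y' _; apply: sqr_ge0.
  move=> /allP /(_ x (mem_index_enum x)) /=.
  by rewrite big_ord1 sqrf_eq0 (ord1 y) => /eqP.
have {IH} [|wf VO sz EA E0] := IH; first by apply: leq_trans nd; rewrite leq_addr.
have [wf' VO' sz' EA' E0'] := step_spec K csvd (B k) nd tau_ge0 wf VO.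
split=> //.
- by apply: leq_trans sz' _; rewrite leq_add2r.
- rewrite [Amat _ _ _](_ : _ = row_mx (Amat A1 B k) (B k)) // EA.
  (* The old perturbation splits off as [E_k 0], and the step treats the remaining
     [U Sigma V^T B]. *)
  by rewrite -[B k in LHS]addr0 -add_row_mx EA' -addrA; congr (_ + _); rewrite addrC.
move=> tau0; have [Ek qr] := E0 tau0; have [ES qr'] := E0' tau0.
have EE : E = row_mx (perturbation K csvd tau A1 h1 B k) 0 +
  so_E (value (step K csvd tau (run K csvd tau A1 h1 B k) (B k))) by [].
split; first by rewrite EE Ek ES row_mx0 addr0.
(* Adding the old rank to both sides combines the growth estimate of the step with the induction
   hypothesis. *)
rewrite -(leq_add2l (rk (run K csvd tau A1 h1 B k))).
by apply: leq_trans qr' _; rewrite addnC leq_add2r.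
Qed.

End Run.

(** Thresholding may lower the rank while all reflectors stay stored, so for general [tau] the
    bounds use the number [q] of stored reflectors. For [tau] = 0 the inequality q <= r yields the
    bounds in terms of [r]. *)
Theorem lemma2p6 :
  exists Cmem : nat, forall csvd : nat, exists Cflop : nat,
  forall (R : realType) (K : routines R) (d : nat) (m : nat -> nat)
    (A1 : 'cV[R]_d) (B : forall k, 'M[R]_(d, m k)) (tau : R) (h1 : 'cV[R]_d),
    A1 != 0 ->
    (forall k, (1 <= m k)%N) ->
    0 <= tau ->
    frob h1 = Num.sqrt 2 ->
    refl h1 *m A1 = frob A1 *: e1 R d ->
  forall k : nat,
    let A := Amat A1 B in
    let n := dimn m in
    let D := run K csvd tau A1 h1 B in
    let E := perturbation K csvd tau A1 h1 B in
    let r := rk (D k) in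
    let q := size (hs (D k)) in
    ((n k <= d)%N ->
       [/\ well_formed (D k),
           [/\ orthogonal_mx (U_of (D k)), orthogonal_mx (Vm (D k)),
               forall i j, 0 <= Sigma_of (D k) i j &
               forall (i : 'I_d) (j : 'I_(n k)),
                 (i : nat) <> j -> Sigma_of (D k) i j = 0],
           A k = U_of (D k) *m Sigma_of (D k) *m (Vm (D k))^T + E k,
           (storage (D k) <= Cmem * (n k ^ 2 + q * d))%N &
           tau = 0 ->
             A k = U_of (D k) *m Sigma_of (D k) *m (Vm (D k))^T /\
             (storage (D k) <= Cmem * (n k ^ 2 + r * d))%N])
    /\
    ((n k.+1 <= d)%N ->
       (step_flops K csvd tau A1 h1 B k
          <= Cflop * (n k.+1 ^ 3 + d * m k * (q + m k)))%N
       /\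
       (tau = 0 ->
        (step_flops K csvd tau A1 h1 B k
          <= Cflop * (n k.+1 ^ 3 + d * m k * (r + m k)))%N)).
Proof.
exists 3 => csvd; exists (csvd + 20)%N => R K d m A1 B tau h1 A1_neq0 m_gt0.
move=> tau_ge0 h1N h1A k A n D E r q.
split=> nd.
  have [wf VO sz EA E0] := run_spec K csvd B A1_neq0 tau_ge0 h1N h1A nd.
  have mem := storage_le (dimn_gt0 m k) wf.
  split=> //.
    split=> //; first exact: U_of_orthogonal nd wf.
      by move=> i j; apply: Sigma_of_ge0.
    by move=> i j; apply: Sigma_of_diag.
  move=> tau0; have [E00 qr] := E0 tau0; split.
    by rewrite /A EA E00 addr0.
  by apply: leq_trans mem _; rewrite leq_mul2l leq_add2l leq_mul2r qr orbT.
have nd' : (n k <= d)%N by apply: leq_trans nd; rewrite leq_addr.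
have [wf VO sz EA E0] := run_spec K csvd B A1_neq0 tau_ge0 h1N h1A nd'.
have [[rn usn] _ _ _] := wf.
have fl := flops_step K csvd tau (B k) nd (m_gt0 k) rn usn sz.
split=> // tau0; have [_ qr] := E0 tau0.
apply: leq_trans fl _.
by rewrite leq_mul2l leq_add2l leq_mul2l leq_add2r qr !orbT.
Qed.
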